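(* Let $f\in\mathcal{R}$, i.e. $f$ is analytic in $\mathbb{D}=\{z\in\mathbb{C}:|z|<1\}$ with Taylor expansion $f(z)=z+\sum_{n=2}^{\infty}a_nz^n$ and $\operatorname{Re} f'(z)>0$ for all $z\in\mathbb{D}$. Then $$|H_3(1)(f^{-1})|\le \frac{44}{135}.$$ This result is sharp: the function $f_0(z)=-z+2\,\mathrm{arctanh}(z)$ belongs to $\mathcal{R}$ and satisfies $|H_3(1)(f_0^{-1})|=\frac{44}{135}$.
   Context: Let $\mathcal{A}$ be the class of analytic functions $f$ in the open unit disc $\mathbb{D}$ with Taylor expansion $f(z)=z+\sum_{n=2}^{\infty}a_nz^n$. The class of bounded turning functions is $\mathcal{R}=\{f\in\mathcal{A}:\operatorname{Re} f'(z)>0,\ z\in\mathbb{D}\}$; its members are univalent in $\mathbb{D}$. For univalent $f\in\mathcal{A}$, the inverse function has an expansion $f^{-1}(w)=w+\sum_{n=2}^{\infty}A_nw^n$ near $w=0$ (valid at least in a disc of radius $1/4$). The third Hankel determinant of the inverse coefficients is, with $A_1=1$, $$H_3(1)(f^{-1})=\det\begin{pmatrix} 1 & A_2 & A_3 \\ A_2 & A_3 & A_4 \\ A_3 & A_4 & A_5 \end{pmatrix}=2A_2A_3A_4-A_3^3-A_4^2+A_3A_5-A_2^2A_5.$$ Here $\mathrm{arctanh}(z)=\sum_{k\ge 0}\frac{z^{2k+1}}{2k+1}$ for $z\in\mathbb{D}$. *)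

(* Defs.v *)
From mathcomp Require Import all_boot all_order all_algebra.
From mathcomp Require Import complex.
From mathcomp Require Import all_classical all_reals all_analysis.

Set Implicit Arguments.
Unset Strict Implicit.
Unset Printing Implicit Defensive.

Import Order.TTheory GRing.Theory Num.Theory.
Import numFieldNormedType.Exports.

Local Open Scope classical_set_scope.
Local Open Scope ring_scope.

(* R[i] packaged as a numClosedFieldType: the topological and normed-module
   structures of MathComp-Analysis are inferred on sorts of number fields, not
   on the bare type R[i].  The norm and 'Re are Cx R-valued, and the order on
   Cx R compares real parts of numbers having the same imaginary part. *)
Definition Cx (R : realType) : numClosedFieldType := R[i].

Section Defs.
Variable R : realType.
Implicit Types (f : Cx R -> Cx R) (a : nat -> Cx R) (z w : Cx R).

Definition unit_disc : set (Cx R) := [set z | `|z| < 1].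

Definition sums_to a z w :=
  series (fun n => a n * z ^+ n) @ \oo --> w.

(* Functions are total, but only their values on the unit disc
   are constrained (the disc is open, so derivatives there see nothing else). *)
Definition normalized_analytic f :=
  (forall z, unit_disc z -> derivable f z 1) /\
  exists a, [/\ a 0%N = 0, a 1%N = 1 &
                forall z, unit_disc z -> sums_to a z (f z)].

Definition bounded_turning f :=
  normalized_analytic f /\
  forall z, unit_disc z -> 0 < 'Re (f^`()%classic z).

(* f^-1 on the image of the unit disc; its values elsewhere are irrelevant. *)
Definition disc_inverse f : Cx R -> Cx R := 'pinv_(fun=> 0) unit_disc f.

(* A is the sequence of coefficients of the expansion of f^-1 near 0. *)
Definition inverse_coefficients f (A : nat -> Cx R) :=
  [/\ A 0%N = 0, A 1%N = 1 &
      \forall w \near (0 : Cx R),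
        (f @` unit_disc) w /\ sums_to A w (disc_inverse f w)].

Definition hankel (q n : nat) a : Cx R :=
  \det (\matrix_(i < q, j < q) a (n + i + j)%N).

Definition arctanh z : Cx R :=
  lim (series (fun k => z ^+ (2 * k + 1) / (2 * k + 1)%:R) @ \oo).

Definition f0 z : Cx R := - z + 2 * arctanh z.

End Defs.

(* Main.v *)
(* Write f' = 1 + c_1 z + c_2 z^2 + ...; since Re f' > 0, the Toeplitz form with
   entries c_n / 2 off the diagonal and 1 on it is nonnegative: it is a limit of
   averages of Re f'(r w) |q(w)|^2 over roots of unity w.  On 5 x 5 matrices this
   yields Schur parameters b, z, x, y in the closed disc with explicit formulas
   for c_1, ..., c_4.  Written with these parameters, H_3(1)(f^-1) is a short
   sum whose triangle inequality reduces the bound 44/135 to a polynomial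
   inequality in t = |b|^2 and |z| on the unit square, where the difference of
   the two sides has nonnegative coefficients in a Bernstein basis.  The value
   44/135 is reached at b = 0, |z| = 1, which is f0.  For f0 the inverse
   series comes from Picard iteration on polynomials, with a majorant, and it
   is the inverse on the disc because Re f0' > 0 makes f0 injective. *)

Require Import Defs.
From mathcomp Require Import all_boot all_order all_algebra.
From mathcomp Require Import complex.
From mathcomp Require Import all_classical all_reals all_analysis.
From mathcomp Require Import cyclic separable cyclotomic.
From mathcomp Require Import ring.
Import Order.TTheory GRing.Theory Num.Theory.
Import numFieldNormedType.Exports.
Local Open Scope classical_set_scope.
Local Open Scope ring_scope.

Set Implicit Arguments.
Unset Strict Implicit.
Unset Printing Implicit Defensive.

(** The partial sums of f' are uniformly close to f' only on discs of radius r < 1. Positivity is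
    therefore proved first for the dilated coefficients (n+1) a_(n+1) r^n, and the dilation is
    removed at the end: the Hankel form has weight 6 in the c_n, so it only picks up a factor r^6.
    The halves c_n / 2 come from Re f' = (f' + conj f') / 2. A Schur parameter is the relative
    position of the next coefficient in the disc that positivity and the earlier coefficients leave
    for it. This disc may shrink to a point; the parameter is then set to 0, so degenerate forms
    follow the generic path. The coefficients of f and of its inverse are related without composing
    power series: f(g(w)) = w is truncated with bounded remainders and divided by w repeatedly. For
    f0, the majorant argument uses only |a_n| <= 1. It makes the Picard iterates bounded on a fixed
    disc, uniformly in the number of steps. *)

(** * Toeplitz forms and Schur parameters *)

Section SchurParameters.
Variable C : numClosedFieldType.
Implicit Types (b z : C).

(** The test value l = - X / |X| turns the form into 2 (N - |X|). *)
Lemma norm_le_of_hermitian2_ge0 (N X : C) : 0 <= N ->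
  (forall l : C, 0 <= N * (1 + l * l^*) + (l * X^* + l^* * X)) -> `|X| <= N.
Proof.
move=> N0 h; have [->|X0] := eqVneq X 0; first by rewrite normr0.
have nX0 : `|X| != 0 by rewrite normr_eq0.
have := h (- (X / `|X|)).
rewrite rmorphN rmorphM /= fmorphV /= (CrealP (normr_real X)).
have -> : N * (1 + - (X / `|X|) * - (X^* / `|X|)) +
    (- (X / `|X|) * X^* + - (X^* / `|X|) * X) =
    N * (1 + X * X^* / `|X| ^+ 2) - 2 * (X * X^* / `|X| ^+ 2) * `|X| by field.
rewrite -normCK divff ?expf_neq0//.
have -> : N * (1 + 1) - 2 * 1 * `|X| = 2 * (N - `|X|) by ring.
by rewrite pmulr_rge0// subr_ge0.
Qed.

(** Normalizes an estimate into a Schur parameter. The case N = 0 forces X = 0 and takes z = 0,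
    which covers parameters on the unit circle. *)
Lemma exists_unit_factor (N X : C) : 0 <= N -> `|X| <= N ->
  exists2 z, `|z| <= 1 & X = N * z.
Proof.
rewrite le_eqVlt => /predU1P[<-|N0] XN.
  exists 0; first by rewrite normr0.
  by rewrite mulr0; apply/eqP; rewrite -normr_eq0 eq_le XN normr_ge0.
exists (X / N); last by rewrite mulrC divfK // gt_eqF.
by rewrite normrM normfV (gtr0_norm N0) ler_pdivrMr // mul1r.
Qed.

Definition toeplitz_form (t : nat -> C) (q : 'I_5 -> C) : C :=
  \sum_(i < 5) \sum_(j < 5) (if (i <= j)%N then t (j - i)%N else (t (i - j)%N)^*)
    * q i * (q j)^*.

Definition vec5 (q0 q1 q2 q3 q4 : C) : 'I_5 -> C :=
  fun i => nth 0 [:: q0; q1; q2; q3; q4] i.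

(** The conjugates enter as separate variables with equations, so that the callers can supply them
    already expanded and leave a plain [ring] identity. *)
Lemma toeplitz_form_vec5 t s1 s2 s3 s4 q1 q2 q3 q4 p1 p2 p3 p4 :
  t 0%N = 1 ->
  (t 1%N)^* = s1 -> (t 2%N)^* = s2 -> (t 3%N)^* = s3 -> (t 4%N)^* = s4 ->
  q1^* = p1 -> q2^* = p2 -> q3^* = p3 -> q4^* = p4 ->
  toeplitz_form t (vec5 1 q1 q2 q3 q4) =
  1 + q1 * p1 + q2 * p2 + q3 * p3 + q4 * p4 +
  (t 1%N * (p1 + q1 * p2 + q2 * p3 + q3 * p4) +
     s1 * (q1 + p1 * q2 + p2 * q3 + p3 * q4)) +
  (t 2%N * (p2 + q1 * p3 + q2 * p4) + s2 * (q2 + p1 * q3 + p2 * q4)) +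
  (t 3%N * (p3 + q1 * p4) + s3 * (q3 + p1 * q4)) +
  (t 4%N * p4 + s4 * q4).
Proof.
move=> t0 t1 t2 t3 t4 e1 e2 e3 e4.
rewrite /toeplitz_form !big_ord_recl !big_ord0 /vec5 /=.
rewrite /bump /= !addn0 !(subSS, subn0) /= t0 e1 e2 e3 e4 t1 t2 t3 t4 rmorph1.
ring.
Qed.

Local Ltac nonneg := repeat lazymatch goal with
  | |- is_true (0 <= _ + _) => apply: addr_ge0
  | |- is_true (0 <= _ * _) => apply: mulr_ge0
  | |- is_true (0 <= _ ^+ _) => apply: exprn_ge0
  | |- is_true (0 <= _^-1) => rewrite invr_ge0
  | |- is_true (0 <= _%:R) => exact: ler0n
  | |- is_true (0 <= `|_|) => exact: normr_ge0
  | |- _ => assumption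
  end.

Local Ltac conj_ring E := rewrite !(rmorphD, rmorphB, rmorphN, rmorphM,
  rmorphXn, rmorph1, rmorph0, rmorph_nat) /= ?E ?conjCK; ring.

(* In the next four lemmas the vector is l z Phi + Phi^*, with Phi the Szego
   polynomial of degree 0, ..., 3 and Phi^* its reversal; the off-diagonal entry
   of the resulting hermitian form in (l, 1) contains the next coefficient t_k. *)
Lemma toeplitz_level1 t l : t 0%N = 1 ->
  toeplitz_form t (vec5 1 l 0 0 0) =
  1 * (1 + l * l^*) + (l * (t 1%N)^* + l^* * t 1%N).
Proof.
move=> t0.
by rewrite (toeplitz_form_vec5 t0 erefl erefl erefl erefl erefl
  (rmorph0 _) (rmorph0 _) (rmorph0 _)); ring.
Qed.

Lemma toeplitz_level2 t b l : t 0%N = 1 -> t 1%N = b ->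
  let X := t 2%N - b ^+ 2 in
  toeplitz_form t (vec5 1 (- b - l * b^*) l 0 0) =
  (1 - b * b^*) * (1 + l * l^*) + (l * X^* + l^* * X).
Proof.
move=> t0 t1 X; set c := b^*; set m := l^*.
have lE : l^* = m by [].
have bE : b^* = c by [].
have cK : c^* = b by exact: conjCK.
have q1 : (- b - l * c)^* = - c - m * b by conj_ring (bE, cK).
rewrite (toeplitz_form_vec5 t0 erefl erefl erefl erefl q1 erefl
  (rmorph0 _) (rmorph0 _)).
have -> : X^* = (t 2%N)^* - c ^+ 2 by rewrite /X; conj_ring (bE, cK).
by rewrite /X t1 -/m -/c; ring.
Qed.

Lemma toeplitz_level3 t b z l :
  let s := 1 - b * b^* in let u := 1 - z * z^* in
  t 0%N = 1 -> t 1%N = b -> t 2%N = b ^+ 2 + s * z ->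
  let X := t 3%N - (b ^+ 3 + s * (2 * b * z - b^* * z ^+ 2)) in
  toeplitz_form t
    (vec5 1 (z * b^* - b - l * z^*) (- z + l * (z^* * b - b^*)) l 0) =
  s * u * (1 + l * l^*) + (l * X^* + l^* * X).
Proof.
move=> s u t0 t1 t2 X.
set c := b^*; set w := z^*; set m := l^*.
have lE : l^* = m by [].
have bE : b^* = c by [].
have cK : c^* = b by exact: conjCK.
have zE : z^* = w by [].
have wK : w^* = z by exact: conjCK.
have sE : s = 1 - b * c by [].
have sK : s^* = s by rewrite sE; conj_ring (bE, cK).
have uE : u = 1 - z * w by [].
(* From here conjugates are opaque variables known only through the recorded equations: conjugation
   is done by rewriting and the rest by [ring]. *)
clearbody s u c w m.
have q1 : (z * c - b - l * w)^* = w * b - c - m * z.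
  by conj_ring (lE, bE, zE, cK, wK, sK).
have q2 : (- z + l * (w * b - c))^* = - w + m * (z * c - b).
  by conj_ring (lE, bE, zE, cK, wK, sK).
have e2 : (t 2%N)^* = c ^+ 2 + s * w.
  by rewrite t2; conj_ring (lE, bE, zE, cK, wK, sK).
rewrite (toeplitz_form_vec5 t0 erefl e2 erefl erefl q1 q2 erefl (rmorph0 _)).
have -> : X^* = (t 3%N)^* - (c ^+ 3 + s * (2 * c * w - b * w ^+ 2)).
  by rewrite /X; conj_ring (lE, bE, zE, cK, wK, sK).
by rewrite /X t2 t1 lE uE bE sE; ring.
Qed.

Lemma toeplitz_level4 t b z x l :
  let s := 1 - b * b^* in let u := 1 - z * z^* in
  t 0%N = 1 -> t 1%N = b -> t 2%N = b ^+ 2 + s * z ->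
  t 3%N = b ^+ 3 + s * (2 * b * z - b^* * z ^+ 2) + s * u * x ->
  let f2 := z^* * b - b^* + x^* * z in
  let f1 := - z^* - x^* * (z * b^* - b) in
  let X := t 4%N - (b ^+ 4 + s * (3 * b ^+ 2 * z - 2 * (b * b^*) * z ^+ 2
     + b^* ^+ 2 * z ^+ 3 + s * z ^+ 2
     + u * (2 * b * x - 2 * b^* * z * x - z^* * x ^+ 2))) in
  toeplitz_form t (vec5 1 (f2^* - l * x^*) (f1^* + l * f1) (- x + l * f2) l) =
  s * u * (1 - x * x^*) * (1 + l * l^*) + (l * X^* + l^* * X).
Proof.
move=> s u t0 t1 t2 t3 f2 f1 X; rewrite /f1 /f2 {f1 f2}.
set c := b^*; set w := z^*; set m := l^*; set y := x^*.
have lE : l^* = m by [].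
have bE : b^* = c by [].
have cK : c^* = b by exact: conjCK.
have zE : z^* = w by [].
have wK : w^* = z by exact: conjCK.
have xE : x^* = y by [].
have yK : y^* = x by exact: conjCK.
have sE : s = 1 - b * c by [].
have sK : s^* = s by rewrite sE; conj_ring (bE, cK).
have uE : u = 1 - z * w by [].
have uK : u^* = u by rewrite uE; conj_ring (zE, wK).
clearbody s u c w y m.
have -> : (w * b - c + y * z)^* = z * c - b + x * w.
  by conj_ring (lE, bE, zE, xE, cK, wK, yK, sK, uK).
have -> : (- w - y * (z * c - b))^* = - z - x * (w * b - c).
  by conj_ring (lE, bE, zE, xE, cK, wK, yK, sK, uK).
have q1 : (z * c - b + x * w - l * y)^* = w * b - c + y * z - m * x.
  by conj_ring (lE, bE, zE, xE, cK, wK, yK, sK, uK).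
have q2 : (- z - x * (w * b - c) + l * (- w - y * (z * c - b)))^* =
  - w - y * (z * c - b) + m * (- z - x * (w * b - c)).
  by conj_ring (lE, bE, zE, xE, cK, wK, yK, sK, uK).
have q3 : (- x + l * (w * b - c + y * z))^* = - y + m * (z * c - b + x * w).
  by conj_ring (lE, bE, zE, xE, cK, wK, yK, sK, uK).
have e2 : (t 2%N)^* = c ^+ 2 + s * w.
  by rewrite t2; conj_ring (lE, bE, zE, xE, cK, wK, yK, sK, uK).
have e3 : (t 3%N)^* =
    c ^+ 3 + s * (2 * c * w - b * w ^+ 2) + s * u * y.
  by rewrite t3; conj_ring (lE, bE, zE, xE, cK, wK, yK, sK, uK).
rewrite (toeplitz_form_vec5 t0 erefl e2 e3 erefl q1 q2 q3 erefl).
have -> : X^* = (t 4%N)^* -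
    (c ^+ 4 + s * (3 * c ^+ 2 * w - 2 * (b * c) * w ^+ 2
     + b ^+ 2 * w ^+ 3 + s * w ^+ 2
     + u * (2 * c * y - 2 * b * w * y - z * y ^+ 2))).
  by rewrite /X; conj_ring (lE, bE, zE, xE, cK, wK, yK, sK, uK).
by rewrite /X t3 t2 t1 lE bE zE uE sE; ring.
Qed.

(** Level k confines t_k to a disc whose centre depends on t_1, ..., t_(k-1) and whose radius is the
    product of the factors 1 - |.|^2 of the earlier parameters. *)
Lemma schur_parameters t : t 0%N = 1 -> (forall q, 0 <= toeplitz_form t q) ->
  exists b z x y, let s := 1 - b * b^* in let u := 1 - z * z^* in
  [/\ [/\ `|b| <= 1, `|z| <= 1, `|x| <= 1 & `|y| <= 1],
      t 1%N = b, t 2%N = b ^+ 2 + s * z,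
      t 3%N = b ^+ 3 + s * (2 * b * z - b^* * z ^+ 2) + s * u * x &
      t 4%N = b ^+ 4 + s * (3 * b ^+ 2 * z - 2 * (b * b^*) * z ^+ 2
     + b^* ^+ 2 * z ^+ 3 + s * z ^+ 2
     + u * (2 * b * x - 2 * b^* * z * x - z^* * x ^+ 2))
     + s * u * (1 - x * x^*) * y].
Proof.
move=> t0 tpos.
have defect_ge0 (z : C) : `|z| <= 1 -> 0 <= 1 - z * z^*.
  by move=> z1; rewrite -normCK subr_ge0 exprn_ile1.
have b1 : `|t 1%N| <= 1.
  by apply: norm_le_of_hermitian2_ge0 => // l; rewrite -toeplitz_level1.
set b := t 1%N in b1; have s0 := defect_ge0 _ b1.
have [|z z1 e2] := @exists_unit_factor (1 - b * b^*) (t 2%N - b ^+ 2) s0.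
  by apply: norm_le_of_hermitian2_ge0 => // l; rewrite -toeplitz_level2.
have u0 := defect_ge0 _ z1.
move/(canRL (subrK _)): e2; rewrite addrC => e2.
have [|x x1 e3] := @exists_unit_factor ((1 - b * b^*) * (1 - z * z^*))
    (t 3%N - (b ^+ 3 + (1 - b * b^*) * (2 * b * z - b^* * z ^+ 2)))
    (mulr_ge0 s0 u0).
  by apply: norm_le_of_hermitian2_ge0 => [|l]; rewrite ?mulr_ge0// -toeplitz_level3.
move/(canRL (subrK _)): e3; rewrite addrC => e3.
have v0 := defect_ge0 _ x1.
have [|y y1 e4] := @exists_unit_factor
    ((1 - b * b^*) * (1 - z * z^*) * (1 - x * x^*))
    (t 4%N - (b ^+ 4 + (1 - b * b^*) * (3 * b ^+ 2 * z
     - 2 * (b * b^*) * z ^+ 2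
     + b^* ^+ 2 * z ^+ 3 + (1 - b * b^*) * z ^+ 2
     + (1 - z * z^*) * (2 * b * x - 2 * b^* * z * x - z^* * x ^+ 2))))
    (mulr_ge0 (mulr_ge0 s0 u0) v0).
  apply: norm_le_of_hermitian2_ge0 => [|l]; first by rewrite !mulr_ge0.
  by rewrite -toeplitz_level4.
move/(canRL (subrK _)): e4; rewrite addrC => e4.
by exists b, z, x, y; split.
Qed.

(* H_3(1)(f^-1) as a polynomial in the Taylor coefficients c_n of f'. *)
Definition hankel_form (c1 c2 c3 c4 : C) : C :=
  c1 * c2 * c3 / 12 + c1 ^+ 2 * c2 ^+ 2 / 12 - c1 ^+ 2 * c4 / 20
  - c1 ^+ 4 * c2 / 16 + c1 ^+ 6 / 64 + c2 * c4 / 15 - 2 * c2 ^+ 3 / 27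
  - c3 ^+ 2 / 16.

(** Here t and x stand for |b|^2 and |z|, and the summands majorize the terms T0, ..., T7 of
    [hankel_form_le]. Equality holds at t = 0, x = 1, which is why the expansion below has no s^3
    x^4 term. *)
Lemma hankel_majorant_le (t x : C) : 0 <= t <= 1 -> 0 <= x <= 1 ->
  let s := 1 - t in
  13 / 540 * t ^+ 3 + 11 / 45 * t ^+ 2 * s * x +
  s * x ^+ 2 * (t * (5 / 9 * s + t / 10)) +
  s * x ^+ 3 * ((27 * t * s + 18 * t ^+ 2 + 44 * s ^+ 2) / 135) +
  t * s ^+ 2 * x ^+ 4 / 60 +
  s * (1 - x ^+ 2) * ((1 + t) / 2 * (s * x / 5 + 4 / 15 * t * x + t / 10
     + s * x ^+ 2 / 30) + (2 / 15 * t + s * (1 / 4 + x / 60)))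
  <= 44 / 135.
Proof.
move=> /andP[t0 t1] /andP[x0 x1] /=; set s := 1 - t; rewrite -subr_ge0.
have s0 : 0 <= s by rewrite subr_ge0.
have y0 : 0 <= 1 - x by rewrite subr_ge0.
(* expansion in the Bernstein basis of bidegree (3, 4) in (t, x) *)
set y := 1 - x in y0.
set L := (X in 0 <= X).
have -> : L = (s ^+ 3 * (41 * y ^+ 4 + 101 * (x * y ^+ 3)
      + 183 * (x ^+ 2 * y ^+ 2) + 114 * (x ^+ 3 * y)) +
    t * s ^+ 2 * (294 * y ^+ 4 + 987 * (x * y ^+ 3)
      + 1113 * (x ^+ 2 * y ^+ 2) + 522 * (x ^+ 3 * y) + 111 * x ^+ 4) +
    t ^+ 2 * s * (402 * y ^+ 4 + 1332 * (x * y ^+ 3)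
      + 1656 * (x ^+ 2 * y ^+ 2) + 996 * (x ^+ 3 * y) + 270 * x ^+ 4) +
    163 * t ^+ 3) / 540.
  by rewrite /L /y /s; field.
by nonneg.
Qed.

Lemma hankel_form_le a : a 0%N = 1 -> (forall q, 0 <= toeplitz_form a q) ->
  `|hankel_form (2 * a 1%N) (2 * a 2%N) (2 * a 3%N) (2 * a 4%N)| <= 44 / 135.
Proof.
move=> a0 /(schur_parameters a0)[b [z [x [y []]]]].
move=> [b1 z1 x1 y1] -> -> -> ->.
have sR : 1 - b * b^* = 1 - `|b| ^+ 2 by rewrite normCK.
have uR : 1 - z * z^* = 1 - `|z| ^+ 2 by rewrite normCK.
have vR : 1 - x * x^* = 1 - `|x| ^+ 2 by rewrite normCK.
have s0 : 0 <= 1 - `|b| ^+ 2 by rewrite subr_ge0 exprn_ile1.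
have u0 : 0 <= 1 - `|z| ^+ 2 by rewrite subr_ge0 exprn_ile1.
have v0 : 0 <= 1 - `|x| ^+ 2 by rewrite subr_ge0 exprn_ile1.
set t := `|b| ^+ 2; set s := 1 - t; set u := 1 - `|z| ^+ 2; set v := 1 - `|x| ^+ 2.
have t0' : 0 <= t by rewrite exprn_ge0.
(* T0, ..., T4 are free of x and y. Everything else carries the factor s u, and T5, T6, T7 are what
   multiplies x, x^2 and v y in it. *)
pose T0 := 13 / 540 * b ^+ 6.
pose T1 := - (11 / 45 * b ^+ 4 * s * z).
pose T2 := s * z ^+ 2 * (b ^+ 2 * (5 / 9 * s + t / 10)).
pose T3 := - (s * z ^+ 3 * ((27 * t * s + 18 * t ^+ 2 + 44 * s ^+ 2) / 135)).
pose T4 := b^* ^+ 2 * s ^+ 2 * z ^+ 4 / 60.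
pose T5 := b * (s * z / 5 + 4 / 15 * t * z) - b ^+ 3 / 10
   - b^* * s * z ^+ 2 / 30.
pose T6 := 2 / 15 * b ^+ 2 * z^* - 4 / 15 * s * `|z| ^+ 2 - s * u / 4.
pose T7 := 4 / 15 * s * z - 2 / 15 * b ^+ 2.
set h := hankel_form _ _ _ _.
have -> : h = T0 + T1 + T2 + T3 + T4 +
    s * u * (x * T5 + (x ^+ 2 * T6 + v * y * T7)).
  rewrite /h /T0 /T1 /T2 /T3 /T4 /T5 /T6 /T7 /hankel_form /s /t /u /v !normCK.
  by field.
have t01 : 0 <= t <= 1 by rewrite t0' exprn_ile1.
have z01 : 0 <= `|z| <= 1 by rewrite normr_ge0.
apply: le_trans (hankel_majorant_le t01 z01).
have nt : `|t| = t by rewrite ger0_norm.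
have ns : `|s| = s by rewrite ger0_norm.
have nu : `|u| = u by rewrite ger0_norm.
have nv : `|v| = v by rewrite ger0_norm.
pose nE := (normrN, normrX, normrM, normfV, norm_conjC, normr_nat, nt, ns, nu, nv,
  normr_id).
have n0 : `|T0| <= 13 / 540 * t ^+ 3 by rewrite !nE -exprM.
have n1 : `|T1| <= 11 / 45 * t ^+ 2 * s * `|z| by rewrite !nE -exprM.
have n2 : `|T2| <= s * `|z| ^+ 2 * (t * (5 / 9 * s + t / 10)).
  by rewrite !nE (@ger0_norm _ (_ + _)) //; nonneg.
have n3 : `|T3| <=
    s * `|z| ^+ 3 * ((27 * t * s + 18 * t ^+ 2 + 44 * s ^+ 2) / 135).
  rewrite !nE (@ger0_norm _ (_ + _)) //.
  by nonneg.
have n4 : `|T4| <= t * s ^+ 2 * `|z| ^+ 4 / 60 by rewrite !nE.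
have n5 : `|T5| <= (1 + t) / 2 * (s * `|z| / 5 + 4 / 15 * t * `|z| + t / 10
     + s * `|z| ^+ 2 / 30).
  (* T5 is odd in b; this arithmetic-geometric mean bound keeps the majorant polynomial in t. *)
  have b2 : `|b| <= (1 + t) / 2.
    rewrite ler_pdivlMr// -subr_ge0.
    have -> : 1 + t - `|b| * 2 = (1 - `|b|) ^+ 2 by rewrite /t; ring.
    by rewrite exprn_ge0 // subr_ge0.
  apply: (@le_trans _ _ (`|b| * (s * `|z| / 5 + 4 / 15 * t * `|z| + t / 10
     + s * `|z| ^+ 2 / 30))); last first.
    by apply: ler_wpM2r => //; nonneg.
  rewrite [`|b| * _]mulrDr (le_trans (ler_normB _ _)) //; apply: lerD; last first.
    by rewrite !nE !mulrA.
  rewrite [`|b| * _]mulrDr (le_trans (ler_normB _ _)) //; apply: lerD; last first.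
    by rewrite !nE (exprS _ 2) /t mulrA.
  rewrite normrM ler_wpM2l // (le_trans (ler_normD _ _)) //.
  by rewrite !nE.
have n67 : `|x ^+ 2 * T6 + v * y * T7| <= 2 / 15 * t + s * (1 / 4 + `|z| / 60).
  (* B dominates the bounds of both |T6| and |T7| and coincides with them at |z| = 1. As |x|^2 + v =
     1 and |y| <= 1, the sum is at most the convex combination |x|^2 B + v B. *)
  set B := (X in _ <= X).
  have n6 : `|T6| <= B.
    apply: (@le_trans _ _ (2 / 15 * t * `|z| + 4 / 15 * s * `|z| ^+ 2 + s * u / 4)).
      rewrite (le_trans (ler_normB _ _)) //; apply: lerD; last by rewrite !nE.
      by rewrite (le_trans (ler_normB _ _)) //; apply: lerD; rewrite !nE.
    rewrite -subr_ge0.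
    have -> : B - (2 / 15 * t * `|z| + 4 / 15 * s * `|z| ^+ 2 + s * u / 4) =
      (1 - `|z|) * (2 / 15 * t + s * `|z| / 60) by rewrite /B /u; field.
    by apply: mulr_ge0; [rewrite subr_ge0 | nonneg].
  have n7 : `|T7| <= B.
    apply: (@le_trans _ _ (4 / 15 * s * `|z| + 2 / 15 * t)).
      by rewrite (le_trans (ler_normB _ _)) //; apply: lerD; rewrite !nE.
    rewrite -subr_ge0.
    have -> : B - (4 / 15 * s * `|z| + 2 / 15 * t) =
      (1 - `|z|) * (s / 4) by rewrite /B; field.
    by apply: mulr_ge0; [rewrite subr_ge0 | nonneg].
  have -> : B = `|x| ^+ 2 * B + v * B by rewrite /v; ring.
  rewrite (le_trans (ler_normD _ _)) //; apply: lerD.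
    by rewrite !nE ler_wpM2l ?exprn_ge0.
  by rewrite !nE ler_pM // ?mulr_ge0 // ler_piMr.
rewrite (le_trans (ler_normD _ _)) //; apply: lerD.
  by do 4 (rewrite (le_trans (ler_normD _ _)) //; apply: lerD => //).
rewrite !nE ler_wpM2l ?mulr_ge0 //.
rewrite (le_trans (ler_normD _ _)) //; apply: lerD => //.
by rewrite normrM (le_trans _ n5) // ler_piMl.
Qed.

End SchurParameters.

(** * Averages over roots of unity *)

Section RootsOfUnity.
Variable C : numClosedFieldType.

Lemma prim_root_exists (n : nat) : (0 < n)%N ->
  exists w : C, n.-primitive_root w.
Proof.
move=> n0; pose p : {poly C} := 'X^n - 1.
have [rs ps] := closed_field_poly_normal p.
have pmon : p \is monic by rewrite monicXnsubC.
have pE : p = \prod_(z <- rs) ('X - z%:P).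
  by rewrite [LHS]ps (monicP pmon) scale1r.
have rsn : size rs = n.
  by apply: succn_inj; rewrite -(size_prod_XsubC rs id) -pE size_XnsubC.
have : has n.-primitive_root rs.
  apply: has_prim_root => //; last by rewrite rsn.
    apply/allP => z zrs; have : root p z by rewrite pE root_prod_XsubC.
    by rewrite rootE !hornerE subr_eq0 unity_rootE.
  rewrite -separable_prod_XsubC -pE separable_Xn_sub_1 ?pnatr_eq0 //.
  by rewrite -lt0n.
by case/hasP => w _ wP; exists w.
Qed.

(** Since |w| = 1, the summands are the powers of v = w^(i-j). Their geometric sum vanishes unless v
    = 1, because v^n = 1. *)
Lemma sum_prim_root (n : nat) (w : C) (i j : nat) : n.-primitive_root w ->
  \sum_(k < n) (w ^+ k) ^+ i * ((w ^+ k) ^+ j)^* =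
    n%:R * (i == j %[mod n])%:R.
Proof.
move=> wP; have n0 := prim_order_gt0 wP.
have w1 : w * w^* = 1.
  rewrite -normCK; apply/eqP; rewrite sqrp_eq1 //.
  by rewrite -(pexpr_eq1 n0) // -normrX (prim_expr_order wP) normr1.
pose v := w ^+ i * w^* ^+ j.
under eq_bigr => k _.
  rewrite !rmorphXn /= exprAC [(w^* ^+ k) ^+ j]exprAC -exprMn -/v.
  over.
have vE : v * w ^+ j = w ^+ i.
  by rewrite /v -mulrA -exprMn [w^* * w]mulrC w1 expr1n mulr1.
have [ij|ij] := boolP (i == j %[mod n]).
  have -> : v = 1.
    move: ij; rewrite -(eq_prim_root_expr wP) => /eqP ij.
    by rewrite /v ij -exprMn w1 expr1n.
  under eq_bigr do rewrite expr1n.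
  by rewrite sumr_const card_ord mulr1.
rewrite mulr0.
have v1 : v - 1 != 0.
  rewrite subr_eq0; apply: contra ij => /eqP v1.
  by rewrite -(eq_prim_root_expr wP) -vE v1 mul1r.
apply: (mulfI v1); rewrite mulr0 -subrX1 /v exprMn exprAC.
rewrite [(w^* ^+ j) ^+ n]exprAC -rmorphXn /= (prim_expr_order wP) rmorph1.
by rewrite !expr1n mulr1 subrr.
Qed.

(** A discrete form of integrating Re p |Q|^2 over the unit circle, where |Q| is at most the sum of
    the |q_i|. The defect e leaves room for the truncation error of f'. *)
Lemma toeplitz_average (c : nat -> C) (N : nat) (e : C) (q : 'I_5 -> C) :
  0 <= e ->
  (forall z, `|z| = 1 -> - e <= 'Re (\sum_(n < N) c n * z ^+ n)) ->
  - (e * (\sum_i `|q i|) ^+ 2) <=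
  'Re (\sum_(n < N) \sum_(i < 5) \sum_(j < 5)
    c n * q i * (q j)^* * (n + i == j)%N%:R).
Proof.
move=> e0 ge_e; set S := \sum_(n < N) _.
have M0 : (0 < N + 5)%N by rewrite addn_gt0 orbT.
(* N + 5 points: n + i and j are smaller, so that n + i = j modulo N + 5 only
   if n + i = j, and the average is exact *)
have [w wP] := prim_root_exists M0; set M := (N + 5)%N in M0 wP.
pose p z := \sum_(n < N) c n * z ^+ n.
pose Q z := \sum_(i < 5) q i * z ^+ i.
have key : \sum_(k < M) p (w ^+ k) * `|Q (w ^+ k)| ^+ 2 = M%:R * S.
  rewrite /S mulr_sumr.
  under [RHS]eq_bigr do rewrite mulr_sumr.
  under [RHS]eq_bigr => n _ do under eq_bigr do rewrite mulr_sumr.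
  transitivity (\sum_(k < M) \sum_(n < N) \sum_(i < 5) \sum_(j < 5)
      c n * q i * (q j)^* * ((w ^+ k) ^+ (n + i) * ((w ^+ k) ^+ j)^*)).
    apply: eq_bigr => k _; rewrite /p mulr_suml; apply: eq_bigr => n _.
    rewrite normCK /Q rmorph_sum mulr_suml mulr_sumr; apply: eq_bigr => i _.
    rewrite mulr_sumr mulr_sumr; apply: eq_bigr => j _.
    by rewrite rmorphM exprD; ring.
  rewrite exchange_big; apply: eq_bigr => n _.
  rewrite exchange_big; apply: eq_bigr => i _.
  rewrite exchange_big; apply: eq_bigr => j _.
  rewrite -mulr_sumr sum_prim_root // !modn_small.
  - by rewrite mulrCA.
  - by rewrite /M (leq_trans (ltn_ord j)) // leq_addl.
  - by rewrite /M -addnS leq_add // ltnW.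
have M0' : 0 < M%:R :> C by rewrite ltr0n.
rewrite -(ler_pM2l M0').
have -> : M%:R * 'Re S = 'Re (M%:R * S) by rewrite ReMl ?rpred_nat.
rewrite -key raddf_sum.
set B := \sum_i `|q i|.
have wk k : `|w ^+ k| = 1.
  have : `|w| = 1.
    by apply/eqP; rewrite -(pexpr_eq1 M0) // -normrX (prim_expr_order wP) normr1.
  by move=> w1; rewrite normrX w1 expr1n.
have QB k : `|Q (w ^+ k)| <= B.
  apply: le_trans (ler_norm_sum _ _ _) _; apply: ler_sum => i _.
  by rewrite normrM normrX wk expr1n mulr1.
apply: (@le_trans _ _ (\sum_(k < M) (- (e * B ^+ 2)))).
  by rewrite sumr_const card_ord mulr_natl.
apply: ler_sum => k _; rewrite /= ReMr ?rpredX ?normr_real //.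
have Q2 : `|Q (w ^+ k)| ^+ 2 <= B ^+ 2 by rewrite lerXn2r ?nnegrE // sumr_ge0.
apply: (@le_trans _ _ (- e * `|Q (w ^+ k)| ^+ 2)).
  by rewrite mulNr lerN2 ler_wpM2l.
by rewrite ler_wpM2r ?exprn_ge0 // ge_e.
Qed.

Definition half_coef (c : nat -> C) (n : nat) : C := if n is 0 then 1 else c n / 2.

(** The sum S carries the entries on and above the diagonal, its conjugate those on and below; their
    half sum is the Toeplitz form. *)
Lemma Re_average_form (c : nat -> C) (N : nat) (q : 'I_5 -> C) : c 0%N = 1 ->
  (5 <= N)%N ->
  'Re (\sum_(n < N) \sum_(i < 5) \sum_(j < 5)
     c n * q i * (q j)^* * (n + i == j)%N%:R) = toeplitz_form (half_coef c) q.
Proof.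
move=> c0 N5; set S := \sum_(n < N) _.
have SE : S = \sum_(i < 5) \sum_(j < 5)
    (if (i <= j)%N then c (j - i)%N else 0) * q i * (q j)^*.
  rewrite /S exchange_big; apply: eq_bigr => i _.
  rewrite exchange_big; apply: eq_bigr => j _ /=.
  have [ij|ij] := leqP i j.
    have jN : (j - i < N)%N.
      by rewrite (leq_trans _ N5) // ltnS (leq_trans (leq_subr _ _)) // -ltnS.
    rewrite (bigD1 (Ordinal jN)) //= subnK // eqxx mulr1 big1 ?addr0 // => n.
    rewrite -val_eqE /= => nij.
    by rewrite -(eqn_add2r i) subnK // in nij; rewrite (negPf nij) mulr0.
  rewrite big1 ?mul0r // => n _.
  by rewrite gtn_eqF ?mulr0 // (leq_trans ij) // leq_addl.
have SJ : S^* = \sum_(i < 5) \sum_(j < 5)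
    (if (j <= i)%N then (c (i - j)%N)^* else 0) * q i * (q j)^*.
  rewrite SE rmorph_sum exchange_big; apply: eq_bigr => j _.
  rewrite rmorph_sum; apply: eq_bigr => i _ /=.
  by rewrite !rmorphM /= conjCK; case: ifP => _; rewrite ?rmorph0; ring.
rewrite ReE SJ SE -big_split /toeplitz_form mulr_suml; apply: eq_bigr => i _.
rewrite -big_split mulr_suml; apply: eq_bigr => j _ /=.
case: (ltngtP i j) => [ij|ij|/val_inj <-].
- rewrite /half_coef; case E: (j - i)%N => [|k]; last by field.
    by move: ij; rewrite -subn_gt0 E.
- rewrite /half_coef; case E: (i - j)%N => [|k].
    by move: ij; rewrite -subn_gt0 E.
  by rewrite fmorph_div /= rmorph_nat; field.
- by rewrite !subnn /half_coef c0 rmorph1; field.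
Qed.
End RootsOfUnity.

(** * Determinants of order two and three *)

Lemma det_mx22 (K : comPzRingType) (M : 'M[K]_2) :
  \det M = M 0 0 * M 1 1 - M 0 1 * M 1 0.
Proof.
rewrite (expand_det_row _ 0) !big_ord_recl big_ord0 /cofactor !det_mx11 !mxE /=.
rewrite /bump /= expr0 mul1r addr0 expr1 mulN1r mulrN.
by congr (_ * M _ _ - M _ _ * M _ _); apply: val_inj.
Qed.
Lemma det_mx33 (K : comPzRingType) (c : nat -> nat -> K) :
  \det (\matrix_(i < 3, j < 3) c i j) =
   c 0%N 0%N * (c 1%N 1%N * c 2%N 2%N - c 1%N 2%N * c 2%N 1%N) -
   c 0%N 1%N * (c 1%N 0%N * c 2%N 2%N - c 1%N 2%N * c 2%N 0%N) +
   c 0%N 2%N * (c 1%N 0%N * c 2%N 1%N - c 1%N 1%N * c 2%N 0%N).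
Proof.
rewrite (expand_det_row _ 0) !big_ord_recl big_ord0 /cofactor !det_mx22 !mxE /=.
rewrite /bump /= ?addn0 expr0 expr1 sqrrN expr1n.
ring.
Qed.

(** * Power series *)

Section PowerSeries.
Variable K : numFieldType.

Lemma norm_lim_le {T : Type} (F : set_system T) {FF : ProperFilter F}
    (g : T -> K) (l B : K) :
  g @ F --> l -> (\forall x \near F, `|g x| <= B) -> `|l| <= B.
Proof.
move=> gl gB; apply/ler_addgt0Pr => e e0.
have /cvgrPdist_lt/(_ e e0) gle := gl.
have [x [le_e leB]] := filter_ex (filterI gle gB).
rewrite -(subrK (g x) l) (le_trans (ler_normD _ _)) // addrC lerD // ltW//.
Qed.

Lemma geometric_sum_le (M q : K) (N n : nat) : 0 <= M -> 0 <= q < 1 -> (N <= n)%N ->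
  \sum_(N <= i < n) M * q ^+ i <= M / (1 - q) * q ^+ N.
Proof.
move=> M0 /andP[q0 q1] Nn.
have q1' : 0 < 1 - q by rewrite subr_gt0.
rewrite -mulr_sumr -mulrA ler_wpM2l // mulrC ler_pdivlMr //.
have -> : (\sum_(N <= i < n) q ^+ i) * (1 - q) = q ^+ N - q ^+ n.
  rewrite mulr_suml -[RHS]opprB -(telescope_sumr _ Nn) -sumrN.
  by apply: eq_bigr => i _; rewrite exprS; ring.
by rewrite gerBl exprn_ge0.
Qed.

Lemma series_tail_le (u : nat -> K) (M q w : K) (N : nat) : 0 <= q < 1 ->
  (forall n, `|u n| <= M * q ^+ n) -> series u @ \oo --> w ->
  `|w - series u N| <= M / (1 - q) * q ^+ N.
Proof.
move=> q01 uM uw.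
have M0 : 0 <= M by have := le_trans (normr_ge0 _) (uM 0%N); rewrite expr0 mulr1.
apply: (@norm_lim_le _ \oo _ (fun n => series u n - series u N)).
  by apply: cvgB => //; exact: cvg_cst.
near=> n; have Nn : (N <= n)%N by near: n; exact: nbhs_infty_ge.
rewrite sub_series_geq // (le_trans (ler_norm_sum _ _ _)) //.
apply: le_trans (geometric_sum_le M0 q01 Nn).
exact: ler_sum.
Unshelve. all: by end_near. Qed.

Lemma cvg_terms_bounded (u : nat -> K) (w : K) : series u @ \oo --> w ->
  exists2 M, 0 < M & forall n, `|u n| <= M.
Proof.
move=> uw; have : u @ \oo --> 0 by apply: cvg_series_cvg_0; apply/cvg_ex; exists w.
move=> /cvgrPdist_lt/(_ 1 ltr01)[N _ uN].
exists (1 + \sum_(i < N) `|u i|).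
  by rewrite ltr_pwDl // sumr_ge0.
move=> n; have [nN|Nn] := ltnP n N.
  by rewrite (bigD1 (Ordinal nN)) //= addrCA lerDl addr_ge0 // sumr_ge0.
have := uN n Nn; rewrite sub0r normrN => /ltW /le_trans; apply.
by rewrite lerDl sumr_ge0.
Qed.

(** The larger radius p absorbs the factor n of the usual bound n r^(n-1), so that the right-hand
    side is geometric in n. *)
Lemma subrXX_le (x y r p : K) (n : nat) : `|x| <= r -> `|y| <= r -> r < p ->
  `|x ^+ n - y ^+ n| <= `|x - y| * (p ^+ n / (p - r)).
Proof.
move=> xr yr rp; have r0 : 0 <= r := le_trans (normr_ge0 _) xr.
have p0 : 0 <= p := le_trans r0 (ltW rp).
rewrite subrXX normrM ler_wpM2l // ler_pdivlMr ?subr_gt0 //.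
apply: (@le_trans _ _ ((\sum_(i < n) p ^+ (n.-1 - i) * r ^+ i) * (p - r))).
  rewrite ler_wpM2r ?subr_ge0 ?(ltW rp)// (le_trans (ler_norm_sum _ _ _)) //.
  apply: ler_sum => i _; rewrite normrM !normrX ler_pM ?exprn_ge0 //.
    by rewrite lerXn2r ?nnegrE // (le_trans xr) // ltW.
  by rewrite lerXn2r ?nnegrE.
by rewrite mulrC -subrXX gerBl exprn_ge0.
Qed.

Definition partial (a : nat -> K) (N : nat) (z : K) := \sum_(n < N) a n * z ^+ n.

Definition partial' (a : nat -> K) (N : nat) (z : K) :=
  \sum_(n < N) a n * (n%:R * z ^+ n.-1).

Lemma partial_seriesE (a : nat -> K) N z :
  partial a N z = series (fun n => a n * z ^+ n) N.
Proof. by rewrite seriesEord. Qed.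

Lemma is_derive_partial (a : nat -> K) (N : nat) (z : K) :
  is_derive z (1 : K) (partial a N) (partial' a N z).
Proof.
have -> : partial a N = \sum_(n < N) (fun x => a n * x ^+ n).
  by apply/funext => x; rewrite fct_sumE.
apply: is_derive_sum => n.
have -> : (fun x => a n * x ^+ n) = a n *: ((@id K) ^+ n).
  by apply/funext => x; rewrite /GRing.scale/= exprfctE.
apply: is_derive_eq; rewrite /GRing.scale/=; ring.
Qed.

(* Used in two directions: to differentiate a power series termwise, and to
   compare a derivative known to exist with those of the partial sums. *)
Lemma diff_quotient_tail (f : K -> K) (a : nat -> K) (r : K) : 0 <= r < 1 ->
  (forall z, `|z| < 1 -> series (fun n => a n * z ^+ n) @ \oo --> f z) ->
  exists M q : K, [/\ 0 <= M, 0 <= q < 1 & forall z N, `|z| <= r ->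
    \forall h \near (0 : K)^',
      `|h^-1 *: (f (h + z) - f z) - h^-1 *: (partial a N (h + z) - partial a N z)|
        <= M * q ^+ N].
Proof.
move=> /andP[r0 r1] fa.
(* The quarter points of [r, 1]: r2 leaves room for z + h, p absorbs the factor n of
   differentiation, and at R1 the terms of the series are bounded. *)
pose r2 := (3 * r + 1) / 4; pose p := (r + 1) / 2; pose R1 := (r + 3) / 4.
have rr2 : r < r2.
  rewrite /r2 ltr_pdivlMr // -subr_gt0.
  by have -> : 3 * r + 1 - r * 4 = 1 - r by [ring]; rewrite subr_gt0.
have r2p : r2 < p.
  rewrite -subr_gt0 /p /r2.
  have -> : (r + 1) / 2 - (3 * r + 1) / 4 = (1 - r) / 4 by field.
  by rewrite divr_gt0 ?subr_gt0.
have pR1 : p < R1.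
  rewrite -subr_gt0 /p /R1.
  have -> : (r + 3) / 4 - (r + 1) / 2 = (1 - r) / 4 by field.
  by rewrite divr_gt0 ?subr_gt0.
have R11 : R1 < 1.
  rewrite /R1 ltr_pdivrMr // mul1r -subr_gt0.
  by have -> : 4 - (r + 3) = 1 - r by [ring]; rewrite subr_gt0.
have p0 : 0 < p by rewrite (le_lt_trans r0) // (lt_trans rr2).
have R0 : 0 < R1 := lt_trans p0 pR1.
clearbody r2 p R1.
have R1n : `|R1| < 1 by rewrite gtr0_norm.
have [M M0 aM] := cvg_terms_bounded (fa _ R1n).
pose q := p / R1; have q01 : 0 <= q < 1.
  by rewrite divr_ge0 ?ltW //= ltr_pdivrMr // mul1r.
exists (M / (p - r2) / (1 - q)), q; split=> //.
  by rewrite !divr_ge0 ?subr_ge0 ?ltW //; case/andP: q01.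
move=> z N zr; near=> h.
have h0 : h != 0 by near: h; exact: nbhs_dnbhs_neq.
have hr : `|h| <= r2 - r.
  near: h; apply: dnbhs0_le; by rewrite subr_gt0.
have z2 : `|z| <= r2 by rewrite (le_trans zr) // ltW.
have zh2 : `|h + z| <= r2.
  by rewrite (le_trans (ler_normD _ _)) // -(subrK r r2) lerD.
have lt1 x : `|x| <= r2 -> `|x| < 1.
  by move=> /le_lt_trans; apply; rewrite (lt_trans r2p) // (lt_trans pR1).
pose u n := h^-1 * (a n * (h + z) ^+ n - a n * z ^+ n).
have sE n : series u n = h^-1 * (series (fun n => a n * (h + z) ^+ n) n -
     series (fun n => a n * z ^+ n) n).
  by rewrite !seriesEnat /= -sumrB mulr_sumr.
have uw : series u @ \oo --> h^-1 * (f (h + z) - f z).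
  have -> : series u = (fun n => h^-1 * (series (fun n => a n * (h + z) ^+ n) n -
     series (fun n => a n * z ^+ n) n)) by apply/funext => n; rewrite sE.
  by apply: cvgZr; apply: cvgB; apply: fa; apply: lt1.
have := @series_tail_le u (M / (p - r2)) q _ N q01 _ uw.
rewrite sE -!partial_seriesE; apply=> n.
rewrite /u -mulrBr normrM normfV normrM.
have := subrXX_le n zh2 z2 r2p; rewrite addrK => hle.
rewrite ler_pdivrMl ?normr_gt0 //.
apply: (le_trans (ler_wpM2l (normr_ge0 (a n)) hle)).
rewrite mulrCA ler_wpM2l //.
have := aM n; rewrite normrM normrX (gtr0_norm R0) => aMn.
have -> : `|a n| * (p ^+ n / (p - r2)) =
    `|a n| * R1 ^+ n * (q ^+ n / (p - r2)).
  have Rn0 : R1 ^+ n != 0 by rewrite expf_neq0 ?gt_eqF.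
  rewrite /q expr_div_n -mulrA; congr (_ * _); rewrite mulrA; congr (_ / _).
  by rewrite [RHS]mulrC divfK.
rewrite -[leRHS]mulrA [(p - r2)^-1 * _]mulrC ler_wpM2r //.
rewrite divr_ge0 ?exprn_ge0 ?subr_ge0 ?(ltW r2p) //.
by case/andP: q01.
Unshelve. all: by end_near. Qed.

Lemma derivable_cvg (f : K -> K) (z : K) : derivable f z 1 ->
  h^-1 *: (f (h + z) - f z) @[h --> (0 : K)^'] --> f^`()%classic z.
Proof.
move=> df; rewrite derive1E /derive.
have -> : (fun h : K => h^-1 *: (f (h + z) - f z)) =
    (fun h : K => h^-1 *: ((f \o shift z) (h *: (1 : K)) - f z)).
  by apply/funext => h /=; rewrite /GRing.scale /= mulr1.
exact: df.
Qed.

Lemma is_derive_of_cvg (f : K -> K) (z L : K) :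
  h^-1 *: (f (h + z) - f z) @[h --> (0 : K)^'] --> L ->
  is_derive z (1 : K) f L.
Proof.
have -> : (fun h : K => h^-1 *: (f (h + z) - f z)) =
    (fun h : K => h^-1 *: ((f \o shift z) (h *: (1 : K)) - f z)).
  by apply/funext => h /=; rewrite /GRing.scale /= mulr1.
move=> fL; apply: DeriveDef; first by apply/cvg_ex; exists L.
exact/cvg_lim.
Qed.

Lemma partial_quotient_cvg (a : nat -> K) (N : nat) (z : K) :
  h^-1 *: (partial a N (h + z) - partial a N z) @[h --> (0 : K)^']
    --> partial' a N z.
Proof.
have D := is_derive_partial a N z.
have /derivable_cvg := @ex_derive _ _ _ _ _ _ _ D.
by rewrite derive1E (@derive_val _ _ _ _ _ _ _ D).
Qed.

End PowerSeries.

(** * Termwise differentiation over the complex numbers *)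

Section ComplexSeries.
Local Open Scope complex_scope.
Variable R : realType.
Local Notation C := (Cx R).

Lemma complex_pos_real (e : C) : 0 < e -> exists2 r : R, 0 < r & e = r%:C.
Proof.
move=> e0; exists (complex.Re e); first by move: e0; rewrite ltcE => /andP[].
by rewrite RRe_real // gtr0_real.
Qed.

Lemma expr_cvg0 (q : C) : 0 <= q < 1 -> (fun n => q ^+ n) @ \oo --> (0 : C).
Proof.
move=> /andP[q0 q1]; apply/cvgrPdist_lt => e /complex_pos_real[r r0 ->].
have qR : q = (complex.Re q)%:C by rewrite RRe_real // ger0_real.
have p0 : 0 <= complex.Re q by move: q0; rewrite {1}qR ler0c.
have p1 : complex.Re q < 1 by move: q1; rewrite {1}qR -[1]/(1%:C) ltcR.
have /cvg_expr/cvgrPdist_lt/(_ r r0) : `|complex.Re q| < 1 by rewrite ger0_norm.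
apply: filterS => n; rewrite !sub0r !normrN !ger0_norm ?exprn_ge0 //.
by rewrite {2}qR -rmorphXn /= ltcR.
Qed.

Lemma ler_geometric (x B M q : C) : 0 <= M -> 0 <= q < 1 ->
  (forall N, x <= B + M * q ^+ N) -> x <= B.
Proof.
move=> M0 q01 xB; apply/ler_addgt0Pr => e e0.
have : (fun n => M * q ^+ n) @ \oo --> (0 : C).
  by rewrite -[0](mulr0 M); apply: cvgZr; exact: expr_cvg0.
move=> /cvgrPdist_lt/(_ e e0)/filter_ex[n]; rewrite sub0r normrN.
rewrite ger0_norm; last by rewrite mulr_ge0 // exprn_ge0 //; case/andP: q01.
by move=> /ltW le_e; rewrite (le_trans (xB n)) // lerD2l.
Qed.

Lemma derive_partial_le (f : C -> C) (a : nat -> C) (r : C) : 0 <= r < 1 ->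
  (forall z, `|z| < 1 -> derivable f z 1) ->
  (forall z, `|z| < 1 -> sums_to a z (f z)) ->
  exists M q : C, [/\ 0 <= M, 0 <= q < 1 & forall z N, `|z| <= r ->
    `|f^`()%classic z - partial' a N z| <= M * q ^+ N].
Proof.
move=> /[dup] r01 /andP[r0 r1] df fa.
have [M [q [M0 q01 H]]] := diff_quotient_tail r01 fa.
exists M, q; split=> // z N zr; apply: norm_lim_le (H z N zr).
apply: cvgB; last exact: partial_quotient_cvg.
by apply: derivable_cvg; apply: df; exact: le_lt_trans r1.
Qed.

Lemma is_derive_power_series (f : C -> C) (a : nat -> C) (z L : C) :
  `|z| < 1 -> (forall z, `|z| < 1 -> sums_to a z (f z)) ->
  (fun N => partial' a N z) @ \oo --> L -> is_derive z (1 : C) f L.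
Proof.
move=> z1 fa aL; apply: is_derive_of_cvg.
have z01 : 0 <= `|z| < 1 by rewrite normr_ge0.
have [M [q [M0 q01 H]]] := diff_quotient_tail z01 fa.
apply/cvgrPdist_lt => e e0; have e3 : 0 < e / 3 by rewrite divr_gt0.
have /cvgrPdist_lt/(_ _ e3) MN : (fun n => M * q ^+ n) @ \oo --> (0 : C).
  by rewrite -[0](mulr0 M); apply: cvgZr; exact: expr_cvg0.
have /cvgrPdist_lt/(_ _ e3) aLe := aL.
have [N [LN]] := filter_ex (filterI aLe MN).
rewrite sub0r normrN ger0_norm; last first.
  by rewrite mulr_ge0 // exprn_ge0 //; case/andP: q01.
move=> MNe; have /cvgrPdist_lt/(_ _ e3) := @partial_quotient_cvg _ a N z.
apply: filterS2 (H z N (lexx _)) => h; set u := _ *: _; set v := _ *: _.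
move=> uv pv.
have -> : L - u = (L - partial' a N z) + (partial' a N z - v) - (u - v) by ring.
have -> : e = e / 3 + e / 3 + e / 3 by field.
rewrite (le_lt_trans (ler_normB _ _)) // ltrD //; last exact: le_lt_trans MNe.
by rewrite (le_lt_trans (ler_normD _ _)) // ltrD.
Qed.

End ComplexSeries.

(** * Positivity of the Toeplitz form of f' and the coefficient bound *)

Section Positivity.
Local Open Scope complex_scope.
Variable R : realType.
Local Notation C := (Cx R).

Lemma Re_le_norm_sub (x y : C) : 0 <= 'Re x -> - `|x - y| <= 'Re y.
Proof.
move=> x0; have -> : 'Re y = 'Re x - 'Re (x - y) by rewrite raddfB /= subKr.
rewrite -[leLHS]add0r lerB //.
by have [] := leif_Re_Creal (x - y).
Qed.

(** Truncating f' on |z| <= r lowers its positive real part by at most a geometric error, so the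
    form is at least minus a multiple of p^N for every N. *)
Lemma toeplitz_positivity (f : C -> C) (a : nat -> C) (r : C) :
  0 <= r < 1 -> a 1%N = 1 ->
  (forall z, `|z| < 1 -> derivable f z 1) ->
  (forall z, `|z| < 1 -> sums_to a z (f z)) ->
  (forall z, `|z| < 1 -> 0 < 'Re (f^`()%classic z)) ->
  forall q, 0 <= toeplitz_form
    (half_coef (fun n => n.+1%:R * a n.+1 * r ^+ n)) q.
Proof.
move=> r01 a1 df fa f'0 q; set c := fun n : nat => _.
have [M [p [M0 p01 Mp]]] := derive_partial_le r01 df fa.
have c0 : c 0%N = 1 by rewrite /c a1 !mul1r.
pose B := \sum_i `|q i|.
have B0 : 0 <= B by apply: sumr_ge0.
apply: (@ler_geometric _ _ _ (M * p ^+ 6 * B ^+ 2) p) => //.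
  by rewrite !mulr_ge0 ?exprn_ge0 //; case/andP: p01.
move=> N; pose e := M * p ^+ (N + 6).
have e0 : 0 <= e by rewrite mulr_ge0 ?exprn_ge0 //; case/andP: p01.
have N5 : (5 <= N + 5)%N by rewrite leq_addl.
rewrite -(Re_average_form q c0 N5) -lerBlDr sub0r.
have -> : M * p ^+ 6 * B ^+ 2 * p ^+ N = e * B ^+ 2.
  by rewrite /e exprD; ring.
apply: toeplitz_average => // z z1.
have rz : `|r * z| <= r by rewrite normrM z1 mulr1 ger0_norm //; case/andP: r01.
(* The term of index 0 of [partial'] vanishes: N + 6 coefficients of f give N + 5 of f'. *)
have -> : \sum_(n < N + 5) c n * z ^+ n = partial' a (N + 6) (r * z).
  rewrite /partial' (addnS N 5) big_ord_recl /= mul0r mulr0 add0r.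
  by apply: eq_bigr => i _; rewrite /bump add1n /c /= exprMn; ring.
have := Re_le_norm_sub (partial' a (N + 6) (r * z))
  (ltW (f'0 _ (le_lt_trans rz (andP r01).2))).
apply: le_trans; rewrite lerN2; exact: Mp.
Qed.

Lemma hankel_form_homogeneous (r c1 c2 c3 c4 : C) :
  hankel_form (c1 * r) (c2 * r ^+ 2) (c3 * r ^+ 3) (c4 * r ^+ 4) =
  hankel_form c1 c2 c3 c4 * r ^+ 6.
Proof. by rewrite /hankel_form; field. Qed.

(** Take r = 1 - s and Bernoulli's inequality (1 - s)^6 >= 1 - 6 s. The denominator d of s = e / d
    makes both s <= 1 and 6 x s <= e true. *)
Lemma ler_of_scaled (x B : C) : 0 <= x ->
  (forall r, 0 <= r < 1 -> x * r ^+ 6 <= B) -> x <= B.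
Proof.
move=> x0 xB; apply/ler_addgt0Pr => e e0.
pose d := e + 6 * x + 1; have d0 : 0 < d.
  by rewrite /d ltr_pwDr // addr_ge0 ?mulr_ge0 // ltW.
pose s := e / d.
have s0 : 0 < s by rewrite divr_gt0.
have s1 : s <= 1 by rewrite ler_pdivrMr // mul1r /d -addrA lerDl addr_ge0 ?mulr_ge0.
have xs : 6 * x * s <= e.
  rewrite /s mulrCA ger_pMr // ler_pdivrMr // mul1r /d.
  by rewrite addrAC lerDr addr_ge0 // ltW.
have t0 : 0 <= 1 - s by rewrite subr_ge0.
have t1 : 0 <= 1 - s < 1 by rewrite t0 gtrBl.
rewrite -lerBlDr; apply: le_trans (xB _ t1).
apply: (@le_trans _ _ (x - 6 * x * s)); first by rewrite lerD2l lerN2.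
rewrite -subr_ge0; set t := 1 - s in t0 t1 *.
have -> : x * t ^+ 6 - (x - 6 * x * s) =
    x * s ^+ 2 * (t ^+ 4 + 2 * t ^+ 3 + 3 * t ^+ 2 + 4 * t + 5).
  by rewrite /t; ring.
apply: mulr_ge0; first by rewrite mulr_ge0 // exprn_ge0 // ltW.
by rewrite !addr_ge0 // ?mulr_ge0 // exprn_ge0.
Qed.

Lemma hankel_form_bound (f : C -> C) (a : nat -> C) : a 1%N = 1 ->
  (forall z, `|z| < 1 -> derivable f z 1) ->
  (forall z, `|z| < 1 -> sums_to a z (f z)) ->
  (forall z, `|z| < 1 -> 0 < 'Re (f^`()%classic z)) ->
  `|hankel_form (2 * a 2%N) (3 * a 3%N) (4 * a 4%N) (5 * a 5%N)| <= 44 / 135.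
Proof.
move=> a1 df fa f'0; apply: ler_of_scaled => // r r01.
have /(hankel_form_le erefl) := toeplitz_positivity r01 a1 df fa f'0.
rewrite /half_coef !(mulrC 2) !divfK ?pnatr_eq0 // hankel_form_homogeneous.
by rewrite normrM normrX (ger0_norm (andP r01).1).
Qed.

End Positivity.

(** * The expansion of the inverse function *)

Section InverseSeries.
Variable K : numFieldType.

Definition bounded_at0 (F : K -> K) :=
  exists M, \forall w \near (0 : K)^', `|F w| <= M.

Lemma bounded_at0_cst c : bounded_at0 (fun=> c).
Proof. by exists `|c|; near=> w. Unshelve. all: by end_near. Qed.

Lemma bounded_at0_id : bounded_at0 id.
Proof. by exists 1; apply: dnbhs0_le. Qed.

Lemma bounded_at0D F G : bounded_at0 F -> bounded_at0 G ->
  bounded_at0 (fun w => F w + G w).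
Proof.
move=> [M FM] [N GN]; exists (M + N); apply: filterS2 FM GN => w Fw Gw.
by rewrite (le_trans (ler_normD _ _)) // lerD.
Qed.

Lemma bounded_at0M F G : bounded_at0 F -> bounded_at0 G ->
  bounded_at0 (fun w => F w * G w).
Proof.
move=> [M FM] [N GN]; exists (M * N); apply: filterS2 FM GN => w Fw Gw.
by rewrite normrM ler_pM.
Qed.

(** One step of coefficient comparison: it reads off the constant term and returns the relation
    divided by w, ready for the next step. *)
Lemma bounded_at0_eq0 (c : K) (F : K -> K) : bounded_at0 F ->
  (\forall w \near (0 : K)^', c + w * F w = 0) ->
  c = 0 /\ \forall w \near (0 : K)^', F w = 0.
Proof.
move=> [M FM] cF; have c0 : c = 0.
  apply/eqP; rewrite -normr_le0; apply/ler_addgt0Pr => e e0; rewrite add0r.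
  have [v Fv] := filter_ex FM.
  have M0 : 0 <= M := le_trans (normr_ge0 _) Fv.
  have M1 : 0 < M + 1 by rewrite ltr_pwDr.
  near (0 : K)^' => w.
  have Fw : `|F w| <= M by near: w.
  have we : `|w| <= e / (M + 1) by near: w; apply: dnbhs0_le; rewrite divr_gt0.
  have /eqP : c + w * F w = 0 by near: w.
  rewrite addr_eq0 => /eqP ->; rewrite normrN normrM.
  apply: (le_trans (ler_pM _ _ we Fw)) => //.
  by rewrite mulrAC ler_pdivrMr // ler_wpM2l // ?ltW // ltrDl.
split=> //; near=> w.
have w0 : w != 0 by near: w; exact: nbhs_dnbhs_neq.
have : c + w * F w = 0 by near: w.
by rewrite c0 add0r => /eqP; rewrite mulf_eq0 (negPf w0) => /eqP.
Unshelve. all: by end_near. Qed.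

Ltac bounded_tac := repeat first
  [ assumption | exact: bounded_at0_cst | exact: bounded_at0_id
  | apply: bounded_at0D | apply: bounded_at0M ].

(* Here [k w] is the quotient g(w) / w for the inverse series g. *)
Lemma inverse_expansion (a2 a3 a4 a5 A2 A3 A4 A5 : K) (e h : K -> K) :
  bounded_at0 e -> bounded_at0 h ->
  (\forall w \near (0 : K)^',
     let k := 1 + w * (A2 + w * (A3 + w * (A4 + w * (A5 + w * e w)))) in
     1 = k + a2 * w * k ^+ 2 + a3 * w ^+ 2 * k ^+ 3 + a4 * w ^+ 3 * k ^+ 4 +
       a5 * w ^+ 4 * k ^+ 5 + h w * w ^+ 5) ->
  [/\ A2 + a2 = 0, A3 + 2 * a2 * A2 + a3 = 0,
      A4 + a2 * (2 * A3 + A2 ^+ 2) + 3 * a3 * A2 + a4 = 0 &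
      A5 + a2 * (2 * A4 + 2 * A2 * A3) + a3 * (3 * A3 + 3 * A2 ^+ 2) +
        4 * a4 * A2 + a5 = 0].
Proof.
move=> be bh E.
pose k4 w := A5 + w * e w; pose k3 w := A4 + w * k4 w.
pose k2 w := A3 + w * k3 w; pose k1 w := A2 + w * k2 w.
pose k w := 1 + w * k1 w.
have b4 : bounded_at0 k4 by rewrite /k4; bounded_tac.
have b3 : bounded_at0 k3 by rewrite /k3; bounded_tac.
have b2 : bounded_at0 k2 by rewrite /k2; bounded_tac.
have b1 : bounded_at0 k1 by rewrite /k1; bounded_tac.
have b : bounded_at0 k by rewrite /k; bounded_tac.
(* Each stage writes the relation as a constant plus w times a bounded function, using k = 1 + w k1
   and k1 = A2 + w k2, and so on; for instance k^2 - 1 = w k1 (1 + k). Powers are spelled as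
   products, the form that [bounded_tac] handles. *)
have [E2 F1] : A2 + a2 = 0 /\ \forall w \near (0 : K)^',
    k2 w + a2 * (k1 w * (1 + k w)) + a3 * (k w * (k w * k w)) +
    a4 * (w * (k w * (k w * (k w * k w)))) +
    a5 * (w * (w * (k w * (k w * (k w * (k w * k w)))))) +
    h w * (w * (w * w)) = 0.
  apply: bounded_at0_eq0; first by bounded_tac.
  near=> w; have w0 : w != 0 by near: w; exact: nbhs_dnbhs_neq.
  have := near E w; rewrite -/(k4 w) -/(k3 w) -/(k2 w) -/(k1 w) -/(k w) /=.
  move=> Ew; apply: (mulfI w0); rewrite mulr0.
  have : k w + a2 * w * k w ^+ 2 + a3 * w ^+ 2 * k w ^+ 3 +
    a4 * w ^+ 3 * k w ^+ 4 + a5 * w ^+ 4 * k w ^+ 5 + h w * w ^+ 5 - 1 = 0.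
    by rewrite -Ew ?subrr //; near: w.
  move <-.
  transitivity (w * k1 w + a2 * w * (1 + w * (k1 w * (1 + k w))) +
    a3 * w ^+ 2 * k w ^+ 3 + a4 * w ^+ 3 * k w ^+ 4 + a5 * w ^+ 4 * k w ^+ 5
    + h w * w ^+ 5); first by rewrite {2}/k1; ring.
  by rewrite /k; ring.
have [E3 F2] : A3 + 2 * a2 * A2 + a3 = 0 /\ \forall w \near (0 : K)^',
    k3 w + a2 * (2 * k2 w + k1 w * k1 w) +
    a3 * (k1 w * (1 + k w + k w * k w)) +
    a4 * (k w * (k w * (k w * k w))) +
    a5 * (w * (k w * (k w * (k w * (k w * k w))))) + h w * (w * w) = 0.
  apply: bounded_at0_eq0; first by bounded_tac.
  near=> w; transitivity (k2 w + a2 * (k1 w * (1 + k w)) +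
    a3 * (k w * (k w * k w)) + a4 * (w * (k w * (k w * (k w * k w)))) +
    a5 * (w * (w * (k w * (k w * (k w * (k w * k w)))))) +
    h w * (w * (w * w))); last by near: w.
  by rewrite /k /k1 /k2; ring.
have [E4 F3] : A4 + a2 * (2 * A3 + A2 ^+ 2) + 3 * a3 * A2 + a4 = 0 /\
    \forall w \near (0 : K)^',
    k4 w + a2 * (2 * k3 w + k2 w * (k1 w + A2)) +
    a3 * (3 * k2 w + 3 * (k1 w * k1 w) + w * (k1 w * (k1 w * k1 w))) +
    a4 * (k1 w * (1 + k w + k w * k w + k w * (k w * k w))) +
    a5 * (k w * (k w * (k w * (k w * k w)))) + h w * w = 0.
  apply: bounded_at0_eq0; first by bounded_tac.
  near=> w; transitivity (k3 w + a2 * (2 * k2 w + k1 w * k1 w) +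
    a3 * (k1 w * (1 + k w + k w * k w)) +
    a4 * (k w * (k w * (k w * k w))) +
    a5 * (w * (k w * (k w * (k w * (k w * k w))))) + h w * (w * w));
    last by near: w.
  by rewrite /k /k1 /k2 /k3; ring.
have [E5 F4] : A5 + a2 * (2 * A4 + 2 * A2 * A3) + a3 * (3 * A3 + 3 * A2 ^+ 2) +
        4 * a4 * A2 + a5 = 0 /\
    \forall w \near (0 : K)^',
    e w + a2 * (2 * k4 w + k3 w * (2 * A2 + w * k2 w) + A3 * k2 w) +
    a3 * (3 * k3 w + 3 * (k2 w * (k1 w + A2)) + k1 w * (k1 w * k1 w)) +
    a4 * (4 * k2 w +
      k1 w * (k1 w * (1 + (1 + k w) + (1 + k w + k w * k w)))) +
    a5 * (k1 w * (1 + k w + k w * k w + k w * (k w * k w)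
       + k w * (k w * (k w * k w)))) + h w = 0.
  apply: bounded_at0_eq0; first by bounded_tac.
  near=> w; transitivity (k4 w + a2 * (2 * k3 w + k2 w * (k1 w + A2)) +
    a3 * (3 * k2 w + 3 * (k1 w * k1 w) + w * (k1 w * (k1 w * k1 w))) +
    a4 * (k1 w * (1 + k w + k w * k w + k w * (k w * k w))) +
    a5 * (k w * (k w * (k w * (k w * k w)))) + h w * w); last by near: w.
  by rewrite /k /k1 /k2 /k3 /k4; ring.
by [].
Unshelve. all: by end_near. Qed.

(** The ratio |z| / r is at most 1/2, so the geometric tail costs at most the factor 2. *)
Lemma series_remainder_le (a : nat -> K) (M r z v : K) (N : nat) : 0 < r ->
  (forall n, `|a n * r ^+ n| <= M) -> `|z| <= r / 2 ->
  series (fun n => a n * z ^+ n) @ \oo --> v ->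
  `|v - partial a N z| <= 2 * M / r ^+ N * `|z| ^+ N.
Proof.
move=> r0 aM zr av; pose q := `|z| / r.
have q0 : 0 <= q by rewrite divr_ge0 // ltW.
have q2 : q <= 1 / 2 by rewrite ler_pdivrMr // mulrC mul1r.
have q1 : q < 1 by rewrite (le_lt_trans q2) // ltr_pdivrMr // mul1r ltr1n.
have q01 : 0 <= q < 1 by rewrite q0.
have M0 : 0 <= M := le_trans (normr_ge0 _) (aM 0%N).
have uM n : `|a n * z ^+ n| <= M * q ^+ n.
  have -> : `|a n * z ^+ n| = `|a n * r ^+ n| * q ^+ n.
    rewrite !normrM !normrX (gtr0_norm r0) -mulrA /q; congr (_ * _).
    by rewrite -exprMn mulrC divfK // gt_eqF.
  by rewrite ler_wpM2r // exprn_ge0.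
rewrite partial_seriesE (le_trans (series_tail_le N q01 uM av)) //.
have -> : 2 * M / r ^+ N * `|z| ^+ N = M * 2 * q ^+ N.
  by rewrite mulrAC -mulrA [2 * M]mulrC /q expr_div_n.
rewrite ler_wpM2r ?exprn_ge0 // ler_wpM2l // -div1r ler_pdivrMr ?subr_gt0 //.
rewrite -subr_ge0; have -> : 2 * (1 - q) - 1 = 2 * (1 / 2 - q) by field.
by rewrite mulr_ge0 // subr_ge0.
Qed.

(** The remainders of order six of g at w and of f at g(w), divided by w^6, are bounded near 0; this
    leaves a polynomial identity with bounded error terms. For the second one, |g(w)| is at most a
    constant times |w|. *)
Lemma inverse_coef_relations (f g : K -> K) (a A : nat -> K) :
  a 0%N = 0 -> a 1%N = 1 -> A 0%N = 0 -> A 1%N = 1 ->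
  (forall z, `|z| < 1 -> series (fun n => a n * z ^+ n) @ \oo --> f z) ->
  (\forall w \near (0 : K), [/\ `|g w| < 1, f (g w) = w &
    series (fun n => A n * w ^+ n) @ \oo --> g w]) ->
  [/\ A 2%N + a 2%N = 0, A 3%N + 2 * a 2%N * A 2%N + a 3%N = 0,
      A 4%N + a 2%N * (2 * A 3%N + A 2%N ^+ 2) + 3 * a 3%N * A 2%N + a 4%N = 0 &
      A 5%N + a 2%N * (2 * A 4%N + 2 * A 2%N * A 3%N) +
        a 3%N * (3 * A 3%N + 3 * A 2%N ^+ 2) + 4 * a 4%N * A 2%N + a 5%N = 0].
Proof.
move=> a0 a1 A0 A1 fa gA.
have [d /= d0 gd] := gA.
have d2 : `|d / 2| < d.
  by rewrite gtr0_norm ?divr_gt0 // ltr_pdivrMr // ltr_pMr // ltr1n.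
have [|_ _ /cvg_terms_bounded[MA _ AM]] := gd (d / 2).
  by rewrite /ball /= sub0r normrN.
have h12 : `|1 / 2 : K| < 1.
  by rewrite gtr0_norm ?divr_gt0 // ltr_pdivrMr // mul1r ltr1n.
have [Ma _ aM] := cvg_terms_bounded (fa _ h12).
have r0 : 0 < 1 / 2 :> K by rewrite divr_gt0.
have d20 : 0 < d / 2 by rewrite divr_gt0.
pose e w := (g w - partial A 6 w) / w ^+ 6.
pose h w := (f (g w) - partial a 6 (g w)) / w ^+ 6.
have be : bounded_at0 e.
  exists (2 * MA / (d / 2) ^+ 6); near=> w.
  have w0 : w != 0 by near: w; exact: nbhs_dnbhs_neq.
  have wd : `|w| <= d / 2 / 2 by near: w; apply: dnbhs0_le; rewrite divr_gt0.
  have [_ _ Aw] : [/\ `|g w| < 1, f (g w) = w &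
    series (fun n => A n * w ^+ n) @ \oo --> g w] by near: w; exact: nbhs_dnbhs.
  rewrite /e normrM normfV normrX ler_pdivrMr ?exprn_gt0 ?normr_gt0 //.
  exact: series_remainder_le AM wd Aw.
pose k w := 1 + w * (A 2%N + w * (A 3%N + w * (A 4%N + w * (A 5%N + w * e w)))).
have bk : bounded_at0 k by rewrite /k; bounded_tac.
have gk w : w != 0 -> g w = w * k w.
  move=> w0; have -> : g w = partial A 6 w + w ^+ 6 * e w.
    by rewrite /e mulrC divfK ?expf_neq0 // addrC subrK.
  by rewrite /partial !big_ord_recl big_ord0 /= /bump /= A0 A1 /k; ring.
have bh : bounded_at0 h.
  have [Mk kM] := bk.
  exists (2 * Ma / (1 / 2) ^+ 6 * Mk ^+ 6); near=> w.
  have w0 : w != 0 by near: w; exact: nbhs_dnbhs_neq.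
  have kw : `|k w| <= Mk by near: w.
  have Mk0 : 0 <= Mk := le_trans (normr_ge0 _) kw.
  (* This gives |g(w)| <= 1/4, half of the radius 1/2 at which the terms of f are bounded by Ma.
     [Mk + 1] is positive even if Mk = 0. *)
  have wk : `|w| <= (1 / 2 / 2) / (Mk + 1).
    near: w; apply: dnbhs0_le; rewrite !divr_gt0 // ltr_pwDr //.
    by have [w kw] := filter_ex kM; exact: le_trans (normr_ge0 _) kw.
  have gle : `|g w| <= `|w| * Mk by rewrite gk // normrM ler_wpM2l.
  have g14 : `|g w| <= 1 / 2 / 2.
    rewrite (le_trans gle) //; move: wk; rewrite ler_pdivlMr ?ltr_pwDr //.
    by apply: le_trans; rewrite ler_wpM2l // lerDl.
  have g1 : `|g w| < 1.
    by rewrite (le_lt_trans g14) // !ltr_pdivrMr // mul1r -natrM ltr1n.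
  rewrite /h normrM normfV normrX ler_pdivrMr ?exprn_gt0 ?normr_gt0 //.
  have := series_remainder_le 6 r0 aM g14 (fa _ g1) => /le_trans; apply.
  rewrite -[leRHS]mulrA ler_wpM2l //; last first.
    by rewrite -exprMn mulrC lerXn2r ?nnegrE // mulr_ge0.
  apply: divr_ge0; last by rewrite exprn_ge0 // ltW.
  rewrite mulr_ge0 //.
  exact: le_trans (aM 0%N).
apply: (inverse_expansion be bh).
near=> w => /=; rewrite -/(k w).
have w0 : w != 0 by near: w; exact: nbhs_dnbhs_neq.
have [_ fgw _] : [/\ `|g w| < 1, f (g w) = w &
    series (fun n => A n * w ^+ n) @ \oo --> g w] by near: w; exact: nbhs_dnbhs.
apply: (mulfI w0); rewrite mulr1 -[LHS]fgw.
have -> : f (g w) = partial a 6 (g w) + w ^+ 6 * h w.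
  by rewrite /h mulrC divfK ?expf_neq0 // addrC subrK.
rewrite gk // /partial !big_ord_recl big_ord0 /= /bump /= a0 a1.
move: (k w) (h w) => ? ?; ring.
Unshelve. all: by end_near. Qed.

End InverseSeries.

(** * The Hankel determinant in terms of the coefficients of f *)

Section Hankel.
Local Open Scope complex_scope.
Variable R : realType.
Local Notation C := (Cx R).

Lemma hankel_3_1E (A : nat -> C) : A 1%N = 1 -> hankel 3 1 A =
  2 * A 2%N * A 3%N * A 4%N - A 3%N ^+ 3 - A 4%N ^+ 2 + A 3%N * A 5%N -
  A 2%N ^+ 2 * A 5%N.
Proof.
move=> A1; rewrite /hankel (det_mx33 (fun i j => A (1 + i + j)%N)) A1 /=.
by ring.
Qed.

Lemma disc_inverseP (f : C -> C) (w : C) : (f @` unit_disc (R:=R)) w ->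
  `|disc_inverse f w| < 1 /\ f (disc_inverse f w) = w.
Proof.
move=> fw; split; last by apply: (pinvK (fun=> 0)); rewrite inE.
apply: (@surjpinv_image_sub _ _ (fun=> 0) (unit_disc (R:=R))
  (f @` unit_disc (R:=R)) f) => //.
by exists w.
Qed.

Lemma hankel_inverseE (f : C -> C) (a A : nat -> C) :
  a 0%N = 0 -> a 1%N = 1 ->
  (forall z, `|z| < 1 -> sums_to a z (f z)) -> inverse_coefficients f A ->
  hankel 3 1 A = hankel_form (2 * a 2%N) (3 * a 3%N) (4 * a 4%N) (5 * a 5%N).
Proof.
move=> a0 a1 fa [A0 A1 gA].
have [|e2 e3 e4 e5] := inverse_coef_relations (g := disc_inverse f) a0 a1 A0 A1 fa.
  by apply: filterS gA => w [/disc_inverseP[? ?] ?].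
rewrite hankel_3_1E //.
have solve (x y : C) : x + y = 0 -> x = - y by move/eqP; rewrite addr_eq0 => /eqP.
(* Right association isolates A_n as the first summand, so the triangular system is eliminated from
   A_5 down to A_2. *)
rewrite -!addrA in e3 e4 e5.
rewrite (solve _ _ e5) (solve _ _ e4) (solve _ _ e3) (solve _ _ e2).
by rewrite /hankel_form; field.
Qed.

Lemma hankel_inverse_bound (f : C -> C) (A : nat -> C) :
  bounded_turning f -> inverse_coefficients f A -> `|hankel 3 1 A| <= 44 / 135.
Proof.
move=> [[df [a [a0 a1 fa]]] f'0] fA.
by rewrite (hankel_inverseE a0 a1 fa fA); exact: hankel_form_bound a1 df fa f'0.
Qed.

End Hankel.

(** * The extremal function *)

Section ExtremalFunction.
Local Open Scope complex_scope.
Variable R : realType.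
Local Notation C := (Cx R).

Lemma normc_le_ReIm (x y : R) : `|(x +i* y : C)| <= (`|x| + `|y|)%:C.
Proof.
have -> : (x +i* y : C) = x%:C + 'i%C * y%:C by rewrite [LHS]complexE.
rewrite (le_trans (ler_normD _ _)) // normrM.
have nE (t : R) : `|(t%:C : C)| = (`|t|)%:C.
  by rewrite normc_def /= expr0n addr0 sqrtr_sqr.
have -> : `|('i%C : C)| = 1 by rewrite normc_def /= expr0n add0r expr1n sqrtr1.
by rewrite mul1r !nE rmorphD.
Qed.

Lemma cvg_complex (T : Type) (F : set_system T) (FF : Filter F)
    (g : T -> C) (a b : R) :
  (fun x => complex.Re (g x)) @ F --> a -> (fun x => complex.Im (g x)) @ F --> b ->
  g @ F --> (a +i* b : C).
Proof.
move=> ga gb; apply/cvgrPdist_lt => e /complex_pos_real[r r0 ->].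
have r2 : 0 < r / 2 by rewrite divr_gt0.
have /cvgrPdist_lt/(_ _ r2) gar := ga; have /cvgrPdist_lt/(_ _ r2) gbr := gb.
apply: filterS2 gar gbr => x ax bx.
case: (g x) ax bx => u v /= ax bx.
apply: (le_lt_trans (normc_le_ReIm (a - u) (b - v))).
by rewrite ltcR [r]splitr ltrD.
Qed.

Lemma cvg_Re (T : Type) (F : set_system T) (FF : Filter F) (g : T -> C) (l : C) :
  g @ F --> l -> (fun x => complex.Re (g x)) @ F --> complex.Re l.
Proof.
move=> gl; apply/cvgrPdist_lt => e e0.
have e0' : 0 < (e%:C : C) by rewrite ltcR.
have /cvgrPdist_lt/(_ _ e0') := gl; apply: filterS => x.
rewrite -raddfB /= => /(le_lt_trans (normc_ge_Re _)).
by rewrite ltcR.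
Qed.

(** Real and imaginary parts are dominated by the same real geometric series, and their sums are
    reassembled. *)
Lemma cvg_geometric_dominated (u : nat -> C) (M q : C) : 0 <= q < 1 ->
  (forall n, `|u n| <= M * q ^+ n) -> exists w : C, series u @ \oo --> w.
Proof.
move=> /andP[q0 q1] uM.
pose m := complex.Re M; pose p := complex.Re q.
have qE : q = p%:C by rewrite RRe_real // ger0_real.
have M0 : 0 <= M by have := le_trans (normr_ge0 _) (uM 0%N); rewrite expr0 mulr1.
have ME : M = m%:C by rewrite RRe_real // ger0_real.
have p0 : 0 <= p by rewrite -lecR -qE.
have p1 : p < 1 by rewrite -ltcR -qE.
have boundRe n : `|complex.Re (u n)| <= m * p ^+ n.
  rewrite -lecR (le_trans (normc_ge_Re _)) // (le_trans (uM n)) //.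
  by rewrite ME qE -rmorphXn -rmorphM.
have boundIm n : `|complex.Im (u n)| <= m * p ^+ n.
  rewrite -lecR -normrN -ReiNIm (le_trans (normc_ge_Re _)) //.
  rewrite normrM (_ : `|('i%C : R[i])| = 1) ?mulr1; last first.
    by rewrite normc_def /= expr0n add0r expr1n sqrtr1.
  by rewrite (le_trans (uM n)) // ME qE -rmorphXn -rmorphM.
have cvgR (v : nat -> R) : (forall n, `|v n| <= m * p ^+ n) -> cvgn (series v).
  move=> vm; apply: normed_cvg.
  apply: (@series_le_cvg _ _ (geometric m p)) => [n|n|n|] //=.
    by rewrite mulr_ge0 ?exprn_ge0 // -ler0c -ME.
  by apply: is_cvg_geometric_series; rewrite ger0_norm.
have /cvg_ex[a va] := cvgR _ boundRe; have /cvg_ex[b vb] := cvgR _ boundIm.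
exists (a +i* b); apply: cvg_complex.
  apply: cvg_trans va.
  rewrite (_ : (fun x => _) = series (fun n => complex.Re (u n))) //.
  by apply/funext => n; rewrite /series /= raddf_sum.
apply: cvg_trans vb.
rewrite (_ : (fun x => _) = series (fun n => complex.Im (u n))) //.
by apply/funext => n; rewrite /series /= raddf_sum.
Qed.

Lemma expr_cvg0C (z : C) : `|z| < 1 -> (fun n => z ^+ n) @ \oo --> (0 : C).
Proof.
move=> z1; apply/cvgrPdist_lt => e e0.
have z01 : 0 <= `|z| < 1 by rewrite normr_ge0.
have /cvgrPdist_lt/(_ _ e0) := expr_cvg0 z01; apply: filterS => n.
by rewrite !sub0r !normrN !normrX normr_id.
Qed.

(** The odd coefficients of 2 arctanh are 2 / n; the summand -z lowers the first from 2 to 1. *)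
Definition f0_coef (n : nat) : C :=
  if odd n then if n == 1%N then 1 else 2 / n%:R else 0.

Lemma f0_coef_even k : f0_coef (2 * k)%N = 0.
Proof. by rewrite /f0_coef mul2n odd_double. Qed.

Lemma f0_coef_odd k : f0_coef (2 * k.+1).+1 = 2 / (2 * k.+1).+1%:R.
Proof. by rewrite /f0_coef mul2n /= odd_double. Qed.

Lemma norm_f0_coef n : `|f0_coef n| <= 1.
Proof.
rewrite /f0_coef; case: n => [|[|[|n]]] /=; rewrite ?normr0 ?normr1 //.
case: ifP => _; rewrite ?normr0 // normf_div !normr_nat ler_pdivrMr ?ltr0n //.
by rewrite mul1r ler_nat.
Qed.

Lemma series_f0_coef (z : C) K :
  series (fun n => f0_coef n * z ^+ n) (2 * K.+1)%N =
  - z + 2 * series (fun k => z ^+ (2 * k + 1) / (2 * k + 1)%:R) K.+1.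
Proof.
elim: K => [|K IH].
  rewrite muln1 !seriesEord /= !big_ord_recl !big_ord0 /f0_coef /= muln0.
  by rewrite add0n divr1; ring.
rewrite mulnS !addSn add0n seriesSr seriesSr IH [in RHS]seriesSr.
rewrite f0_coef_even f0_coef_odd addn1 /=.
by rewrite -[in LHS]mulrA; ring.
Qed.

(** As [arctanh] is a [lim], its series must be shown to converge. The full series converges by
    domination, and its subsequence of even lengths determines the arctanh series. *)
Lemma f0_sums (z : C) : `|z| < 1 -> sums_to f0_coef z (f0 z).
Proof.
move=> z1; have z01 : 0 <= `|z| < 1 by rewrite normr_ge0.
have [|w zw] := @cvg_geometric_dominated (fun n => f0_coef n * z ^+ n) 1 `|z| z01.
  by move=> n; rewrite normrM normrX ler_wpM2r ?exprn_ge0 // norm_f0_coef.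
suff -> : f0 z = w by [].
have dbl : (fun K : nat => (2 * K.+1)%N) @ \oo --> \oo.
  apply/cvgnyPge => A; near=> n.
  rewrite (@leq_trans n) //; first by near: n; exact: nbhs_infty_ge.
  by rewrite (leq_trans (leqnSn n)) // leq_pmull.
have bw : series (fun k => z ^+ (2 * k + 1) / (2 * k + 1)%:R) @ \oo --> (w + z) / 2.
  rewrite -cvg_shiftS /=.
  have -> : (fun K => series (fun k => z ^+ (2 * k + 1) / (2 * k + 1)%:R) K.+1) =
    (fun K => (series (fun n => f0_coef n * z ^+ n) (2 * K.+1)%N + z) / 2).
    by apply/funext => K; rewrite series_f0_coef; field.
  apply: cvgMl; apply: cvgD; last exact: cvg_cst.
  apply: (cvg_comp _ _ dbl zw).
by rewrite /f0 /arctanh (cvg_lim _ bw) //; field.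
Unshelve. all: by end_near. Qed.

End ExtremalFunction.

(** * Bounded turning of the extremal function, and injectivity *)

Section BoundedTurning.
Local Open Scope complex_scope.
Variable R : realType.
Local Notation C := (Cx R).

(** A geometric sum in z^2, since f0' + 1 = 2 / (1 - z^2). The exponent [n.+2./2] counts the odd
    indices below n + 2. *)
Lemma partial'_f0_coef (z : C) n :
  (partial' (f0_coef R) n.+2 z + 1) * (1 - z ^+ 2) =
  2 * (1 - (z ^+ 2) ^+ n.+2./2).
Proof.
elim: n => [|n IH].
  by rewrite /partial' !big_ord_recl big_ord0 /f0_coef /= /bump /=; ring.
rewrite /partial' big_ord_recr -/(partial' _ _ _) addrAC mulrDl {}IH /=.
rewrite uphalf_half /f0_coef /= negbK.
have := odd_double_half n; case: (odd n) => /= nE; last first.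
  by rewrite mul0r mul0r addr0.
have -> : z ^+ n.+1 = (z ^+ 2) ^+ (n./2).+1.
  by rewrite -[in LHS]nE -exprM mulnS mul2n.
rewrite mulrA divfK ?pnatr_eq0 // [in RHS]exprS.
by ring.
Qed.

Lemma one_sub_sqr_neq0 (z : C) : `|z| < 1 -> 1 - z ^+ 2 != 0.
Proof.
move=> z1; rewrite subr_eq0; apply: contraTneq z1 => z2.
have : `|z| ^+ 2 = 1 by rewrite -normrX -z2 normr1.
by move/eqP; rewrite sqrp_eq1 // => /eqP ->; rewrite ltxx.
Qed.

(** With u = z^2 the real part is (1 - |u|^2) / |1 - u|^2. *)
Lemma Re_f0'_gt0 (z : C) : `|z| < 1 -> 0 < 'Re ((1 + z ^+ 2) / (1 - z ^+ 2)).
Proof.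
move=> z1; have u0 := one_sub_sqr_neq0 z1.
have v0 : 1 - (z ^+ 2)^*%R != 0.
  by rewrite -[1](rmorph1 (Num.conj_op : {rmorphism C -> C})) -rmorphB /= conjC_eq0.
rewrite ReE fmorph_div rmorphD rmorphB rmorph1.
set u := z ^+ 2 in u0 v0 *; set v := u^*%R in v0 *.
have -> : ((1 + u) / (1 - u) + (1 + v) / (1 - v)) / 2 =
  (1 - u * v) / ((1 - u) * (1 - v)) by field; rewrite u0 v0.
have -> : (1 - u) * (1 - v) = `|1 - u| ^+ 2.
  by rewrite normCK rmorphB rmorph1.
rewrite divr_gt0 ?exprn_gt0 ?normr_gt0 //.
rewrite /v -normCK subr_gt0 /u normrX -exprM exprn_ilt1 //.
Qed.

Lemma is_derive_f0 (z : C) : `|z| < 1 ->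
  is_derive z (1 : C) (@f0 R) ((1 + z ^+ 2) / (1 - z ^+ 2)).
Proof.
move=> z1; have u0 := one_sub_sqr_neq0 z1.
pose L := 2 * (1 - 0) / (1 - z ^+ 2) - 1.
have LE : (1 + z ^+ 2) / (1 - z ^+ 2) = L by rewrite /L; field.
have half : (fun n => n.+2./2) @ \oo --> \oo.
  apply/cvgnyPge => A; near=> n; rewrite geq_half_double.
  apply: (@leq_trans n); last exact: leqW (leqnSn n).
  by near: n; exact: nbhs_infty_ge.
have z2 : `|z ^+ 2| < 1 by rewrite normrX exprn_ilt1.
have cvgL : (fun n => 2 * (1 - (z ^+ 2) ^+ n.+2./2) / (1 - z ^+ 2) - 1) @ \oo
    --> L.
  have c1 : (fun n => (z ^+ 2) ^+ n.+2./2) @ \oo --> (0 : C).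
    exact: (cvg_comp _ _ half (expr_cvg0C z2)).
  have c4 : (fun=> 1 : C) @ \oo --> (1 : C) by exact: cvg_cst.
  have c2 : (fun n => 1 - (z ^+ 2) ^+ n.+2./2) @ \oo --> (1 - 0 : C).
    exact: (cvgB c4 c1).
  have c3 : (fun n => 2 * (1 - (z ^+ 2) ^+ n.+2./2) / (1 - z ^+ 2)) @ \oo -->
      (2 * (1 - 0) / (1 - z ^+ 2) : C).
    by apply: cvgMl; apply: cvgZr.
  exact: (cvgB c3 c4).
rewrite LE; apply: (is_derive_power_series z1 (@f0_sums R)).
rewrite -(cvg_shiftn 2).
have -> : (fun n => partial' (f0_coef R) (n + 2) z) =
    (fun n => 2 * (1 - (z ^+ 2) ^+ n.+2./2) / (1 - z ^+ 2) - 1).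
  by apply/funext => n; rewrite -partial'_f0_coef addn2 mulfK // addrK.
exact: cvgL.
Unshelve. all: by end_near. Qed.

Lemma bounded_turning_f0 : bounded_turning (@f0 R).
Proof.
split; first split.
- move=> z z1; have D := is_derive_f0 z1.
  exact: (@ex_derive _ _ _ _ _ _ _ D).
- exists (f0_coef R); split=> [//|//|z z1]; exact: f0_sums.
move=> z z1; have D := is_derive_f0 z1.
by rewrite derive1E (@derive_val _ _ _ _ _ _ _ D) Re_f0'_gt0.
Qed.

Lemma cvg_line_dnbhs0 (d : C) : d != 0 ->
  (fun h : R => h%:C * d) @ (0 : R)^' --> (0 : C)^'.
Proof.
move=> d0 A [e /= /complex_pos_real[r r0 ->] eA].
have nd0 : 0 < `|d| by rewrite normr_gt0.
have [s s0 sE] := complex_pos_real nd0.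
suff : \forall h \near (0 : R)^', A (h%:C * d) by [].
near=> h; apply: eA.
  have nh : `|(h%:C : C)| = (`|h|)%:C.
    by rewrite normc_def /= expr0n addr0 sqrtr_sqr.
  suff : `|(0 : C) - h%:C * d| < r%:C by [].
  rewrite sub0r normrN normrM sE nh -rmorphM ltcR -ltr_pdivlMr //.
  by near: h; apply: dnbhs0_lt; rewrite divr_gt0.
rewrite mulf_neq0 // -[0]/(0%:C) (inj_eq (@complexI _)).
by near: h; exact: nbhs_dnbhs_neq.
Unshelve. all: by end_near. Qed.

Lemma is_derive_Re_line (f : C -> C) (u d : C) (t : R) : d != 0 ->
  derivable f (u + t%:C * d) 1 ->
  is_derive t (1 : R)
    (fun s : R => complex.Re (d^*%R * f (u + s%:C * d)))
    (complex.Re (d^*%R * d * f^`()%classic (u + t%:C * d))).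
Proof.
move=> d0 /derivable_cvg df; apply: is_derive_of_cvg.
have := cvg_comp _ _ (cvg_line_dnbhs0 d0) df.
set p := u + t%:C * d in df *; set G := (X in X \o _) => Gd.
have {}Gd : (fun h : R => d^*%R * d * G (h%:C * d)) @ (0 : R)^' -->
    d^*%R * d * f^`()%classic p by apply: cvgZr.
apply: cvg_trans (cvg_Re _ Gd); apply: near_eq_cvg.
near=> h; have h0 : h != 0 by near: h; exact: nbhs_dnbhs_neq.
have hC : (h%:C : C) != 0 by rewrite -[0]/(0%:C) (inj_eq (@complexI _)).
have -> : d^*%R * d * G (h%:C * d) =
    (h^-1)%:C * (d^*%R * f (u + (h + t)%:C * d) - d^*%R * f p).
  have -> : u + (h + t)%:C * d = h%:C * d + p by rewrite /p rmorphD; ring.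
  rewrite /G /GRing.scale /= fmorphV; field.
  by rewrite d0 hC.
have ReM_real (r : R) (x : C) : complex.Re (r%:C * x) = r * complex.Re x.
  by case: x => a b /=; rewrite mul0r subr0.
by rewrite ReM_real raddfB.
Unshelve. all: by end_near. Qed.

(* Noshiro-Warschawski: along the segment from u to z the function
   Re (conj (z - u) * f) is strictly increasing. *)
Lemma bounded_turning_inj (f : C -> C) : bounded_turning f ->
  {in unit_disc (R:=R) &, injective f}.
Proof.
move=> [[df _] f'0] z u; rewrite !inE => z1 u1 fzu.
apply/eqP; rewrite -subr_eq0; apply/negPn/negP => d0; set d := z - u in d0.
pose phi (s : R) := complex.Re (d^*%R * f (u + s%:C * d)).
pose phi' (s : R) := complex.Re (d^*%R * d * f^`()%classic (u + s%:C * d)).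
have seg (t : R) : 0 <= t <= 1 -> unit_disc (u + t%:C * d).
  move=> /andP[t0 t1]; rewrite /unit_disc /=.
  have -> : u + t%:C * d = (1 - t)%:C * u + t%:C * z.
    by rewrite /d rmorphB rmorph1; ring.
  have nE (r : R) : 0 <= r -> `|(r%:C : C)| = r%:C.
    by move=> r0; rewrite ger0_norm // ler0c.
  rewrite (le_lt_trans (ler_normD _ _)) // !normrM !nE ?subr_ge0 //.
  (* Strictness comes from the weight t on |z| < 1, so t = 0 is treated apart, through |u| < 1. *)
  have [t00|t00] := eqVneq t 0.
    by rewrite t00 mul0r addr0 subr0 mul1r.
  have -> : (1 : C) = (1 - t)%:C * 1 + t%:C * 1 by rewrite !mulr1 -rmorphD subrK.
  rewrite ler_ltD //; first by rewrite ler_wpM2l ?ler0c ?subr_ge0 // ltW.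
  by rewrite ltr_pM2l // ltcR lt_neqAle eq_sym t00.
have dphi (t : R) : 0 <= t <= 1 -> is_derive t (1 : R) phi (phi' t).
  by move=> t01; apply: is_derive_Re_line => //; apply: df; exact: seg.
have [t||c c01] := @MVT R phi phi' 0 1 ltr01.
- by rewrite in_itv /= => /andP[t0 t1]; apply: dphi; rewrite !ltW.
- apply: derivable_within_continuous => t; rewrite in_itv /= => t01.
  by have D := dphi _ t01; exact: (@ex_derive _ _ _ _ _ _ _ D).
(* The increment of phi is 0 because f z = f u, whereas its derivative is |d|^2 Re f' > 0. *)
move/eqP; rewrite subr0 mulr1 /phi rmorph1 mul1r rmorph0 mul0r addr0.
rewrite /d addrCA subrr addr0 fzu subrr -/d eq_sym gt_eqF // /phi'.
have cseg : unit_disc (u + c%:C * d).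
  by apply: seg; move: c01; rewrite in_itv /= => /andP[? ?]; rewrite !ltW.
have := f'0 _ cseg; rewrite -complexRe ltcR => F0.
have [s s0 sE] : exists2 s : R, 0 < s & `|d| ^+ 2 = s%:C.
  by apply: complex_pos_real; rewrite exprn_gt0 // normr_gt0.
rewrite [d^*%R * d]mulrC -normCK sE.
case: (f^`()%classic _) F0 => a b /= a0.
by rewrite mul0r subr0 mulr_gt0.
Qed.

End BoundedTurning.

(** * Coefficientwise majorants of polynomials *)

Section Majorant.
Variables (K : numFieldType) (r : K).
Hypothesis r0 : 0 <= r.
Implicit Types p q : {poly K}.

(** Equivalent to bounding the sum of |p_i| r^i by B; leaving the majorant q free makes stability
    under products immediate. *)
Definition poly_majorized p (B : K) :=
  exists q, (forall i, `|p`_i| <= q`_i) /\ q.[r] <= B.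

Lemma majorant_horner_ge0 q : (forall i, 0 <= q`_i) -> 0 <= q.[r].
Proof.
move=> q0; rewrite horner_coef sumr_ge0 // => i _.
by rewrite mulr_ge0 // exprn_ge0.
Qed.

Lemma poly_majorizedX : poly_majorized 'X r.
Proof.
exists 'X; rewrite hornerX; split=> // i.
by rewrite coefX normr_nat.
Qed.

Lemma poly_majorizedD p p' B B' : poly_majorized p B -> poly_majorized p' B' ->
  poly_majorized (p + p') (B + B').
Proof.
move=> [q [pq qB]] [q' [pq' qB']]; exists (q + q'); rewrite hornerD lerD //.
by split=> // i; rewrite !coefD (le_trans (ler_normD _ _)) // lerD.
Qed.

Lemma poly_majorizedM p p' B B' : poly_majorized p B -> poly_majorized p' B' ->
  poly_majorized (p * p') (B * B').
Proof.
move=> [q [pq qB]] [q' [pq' qB']]; exists (q * q'); rewrite hornerM.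
split=> [i|]; last first.
  by apply: ler_pM => //; apply: majorant_horner_ge0 => i;
    apply: le_trans (normr_ge0 _) _.
rewrite !coefM (le_trans (ler_norm_sum _ _ _)) // ler_sum // => j _.
by rewrite normrM ler_pM.
Qed.

Lemma poly_majorizedX_exp p B n : poly_majorized p B ->
  poly_majorized (p ^+ n) (B ^+ n).
Proof.
move=> pB; elim: n => [|n IH]; last by rewrite !exprS; exact: poly_majorizedM.
by exists 1; rewrite hornerC; split=> // i; rewrite expr0 coef1 normr_nat.
Qed.

Lemma poly_majorizedZ c p B : poly_majorized p B ->
  poly_majorized (c *: p) (`|c| * B).
Proof.
move=> [q [pq qB]]; exists (`|c| *: q); rewrite hornerZ ler_wpM2l //.
by split=> // i; rewrite !coefZ normrM ler_wpM2l.
Qed.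

Lemma poly_majorizedN p B : poly_majorized p B -> poly_majorized (- p) B.
Proof.
by move=> [q [pq qB]]; exists q; split=> // i; rewrite coefN normrN.
Qed.

Lemma poly_majorized_sum (n : nat) (p : nat -> {poly K}) (B : nat -> K) :
  (forall i, poly_majorized (p i) (B i)) ->
  poly_majorized (\sum_(i < n) p i) (\sum_(i < n) B i).
Proof.
move=> pB; elim: n => [|n IH]; last by rewrite !big_ord_recr; exact: poly_majorizedD.
by rewrite !big_ord0; exists 0; rewrite horner0; split=> // i; rewrite coef0 normr0.
Qed.

Lemma poly_majorized_le p B B' : B <= B' ->
  poly_majorized p B -> poly_majorized p B'.
Proof. by move=> BB' [q [pq qB]]; exists q; split=> //; exact: le_trans BB'. Qed.

Lemma poly_majorized_coef p B i : poly_majorized p B -> `|p`_i| * r ^+ i <= B.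
Proof.
move=> [q [pq qB]]; apply: le_trans qB.
have q0 j : 0 <= q`_j := le_trans (normr_ge0 _) (pq j).
rewrite (horner_coef_wide _ (leq_maxl (size q) i.+1)).
have im : (i < maxn (size q) i.+1)%N by rewrite leq_maxr.
rewrite (bigD1 (Ordinal im)) //= (le_trans (ler_wpM2r (exprn_ge0 _ r0) (pq i))) //.
by rewrite lerDl sumr_ge0 // => j _; rewrite mulr_ge0 // exprn_ge0.
Qed.

Lemma poly_majorized_horner p B w :
  poly_majorized p B -> `|w| <= r -> `|p.[w]| <= B.
Proof.
move=> [q [pq qB]] wr; apply: le_trans qB.
rewrite (horner_coef_wide w (leq_maxl (size p) (size q))).
rewrite (horner_coef_wide r (leq_maxr (size p) (size q))).
rewrite (le_trans (ler_norm_sum _ _ _)) // ler_sum // => i _.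
by rewrite normrM normrX ler_pM ?exprn_ge0 // lerXn2r ?nnegrE.
Qed.

End Majorant.

(** * Picard iterates for the inverse series *)

Lemma dvdp_sum (K : fieldType) (d : {poly K}) n (F : 'I_n -> {poly K}) :
  (forall i, d %| F i) -> d %| \sum_(i < n) F i.
Proof.
move=> dF; apply: (big_ind (fun p => d %| p)) => [|p q|i _].
- exact: dvdp0.
- exact: dvdp_add.
- exact: dF.
Qed.

Section Iterates.
Variables (K : numFieldType) (a : nat -> K).

Definition higher_coef n := if (n < 2)%N then 0 else a n.

(* Picard iterates of g = w - (a_2 g^2 + a_3 g^3 + ...) *)
Fixpoint inverse_iterate N : {poly K} :=
  if N is N'.+1 then
    'X - \sum_(n < N'.+2) higher_coef n *: inverse_iterate N' ^+ n
  else 0.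

Local Notation P := inverse_iterate.

Lemma inverse_iterateS N :
  P N.+1 = 'X - \sum_(n < N.+2) higher_coef n *: P N ^+ n.
Proof. by []. Qed.

Lemma dvdX_inverse_iterate N : 'X %| P N.
Proof.
elim: N => [|N IH]; first exact: dvdp0.
rewrite inverse_iterateS dvdp_sub //; apply: dvdp_sum => i.
rewrite /higher_coef; case: ltnP => i2; first by rewrite scale0r dvdp0.
by rewrite -mul_polyC dvdp_mull // (dvdp_trans IH) // dvdp_exp // ltnW.
Qed.

(** Each step settles one more coefficient: for i >= 2, x^i - y^i has the factor x - y and one
    further factor X, and the newly added power of x is divisible by X^(N+2). *)
Lemma dvdX_inverse_iterate_sub N : 'X^(N.+1) %| P N.+1 - P N.
Proof.
elim: N => [|N IH].
  by rewrite subr0 inverse_iterateS !big_ord_recl big_ord0 /higher_coef /=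
     !scale0r !addr0 subr0 expr1.
rewrite [P N.+2]inverse_iterateS [X in _ - X]inverse_iterateS big_ord_recr /=.
set x := P N.+1; set y := P N.
have -> : 'X - (\sum_(i < N.+2) higher_coef i *: x ^+ i +
     higher_coef N.+2 *: x ^+ N.+2) -
   ('X - \sum_(i < N.+2) higher_coef i *: y ^+ i) =
   - (\sum_(i < N.+2) higher_coef i *: (x ^+ i - y ^+ i) +
      higher_coef N.+2 *: x ^+ N.+2).
  under [in RHS]eq_bigr do rewrite scalerBr.
  by rewrite sumrB; ring.
rewrite dvdpNr dvdp_add //; last first.
  rewrite -mul_polyC dvdp_mull // dvdp_exp2r //; exact: dvdX_inverse_iterate.
apply: dvdp_sum => i.
rewrite /higher_coef; case: ltnP => i2; first by rewrite scale0r dvdp0.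
rewrite -mul_polyC dvdp_mull // subrXX exprSr dvdp_mul //.
apply: dvdp_sum => j.
(* As i - 1 >= 1, one of the exponents i - 1 - j and j is positive and supplies the extra X. *)
have [i1j|] := ltnP 0 (i.-1 - j).
  by rewrite dvdp_mulr // (dvdp_trans (dvdX_inverse_iterate N.+1)) // dvdp_exp.
rewrite leqn0 => /eqP ij.
rewrite dvdp_mull // (dvdp_trans (dvdX_inverse_iterate N)) // dvdp_exp //.
move/eqP: ij; rewrite subn_eq0; apply: leq_trans.
by rewrite -ltnS prednK // ltnW.
Qed.

Definition inverse_coef n := (P n)`_n.

Lemma coef_inverse_iterate N n : (n <= N)%N -> (P N)`_n = inverse_coef n.
Proof.
move=> /subnK <-; elim: (N - n)%N => [//|k IH].
rewrite addSn -IH; apply/eqP; rewrite -subr_eq0 -coefB.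
have /dvdpP[q ->] := dvdX_inverse_iterate_sub (k + n).
by rewrite coefMXn ltnS leq_addl.
Qed.

Lemma inverse_coef0 : inverse_coef 0 = 0.
Proof. by rewrite /inverse_coef /= coef0. Qed.

Lemma inverse_coef1 : inverse_coef 1 = 1.
Proof.
by rewrite /inverse_coef inverse_iterateS !big_ord_recl big_ord0 /higher_coef /=
  !scale0r !addr0 subr0 coefX.
Qed.

Hypothesis a_le1 : forall n, `|a n| <= 1.

(** With |a_n| <= 1 a step sends a bound B to at most r + B^2 / (1 - B). For r = 1/8 and B = 1/4
    this is 5/24 <= 1/4, so the bound reproduces itself. *)
Lemma inverse_iterate_majorized N : poly_majorized (1 / 8) (P N) (1 / 4).
Proof.
have r0 : 0 <= 1 / 8 :> K by rewrite divr_ge0.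
elim: N => [|N IH].
  by exists 0; rewrite horner0 divr_ge0 //; split=> // i; rewrite coef0 normr0.
rewrite inverse_iterateS.
apply: (@poly_majorized_le _ _ _
  (1 / 8 + \sum_(n < N.+2) `|higher_coef n| * (1 / 4) ^+ n)).
  rewrite -(big_mkord xpredT (fun n => `|higher_coef n| * (1 / 4) ^+ n)).
  rewrite big_ltn // big_ltn // /higher_coef /= !normr0 !mul0r !add0r.
  apply: (@le_trans _ _ (1 / 8 + 1 / (1 - 1 / 4) * (1 / 4) ^+ 2)); last first.
    have -> : 1 / 8 + 1 / (1 - 1 / 4) * (1 / 4) ^+ 2 = 5 / 24 :> K by field.
    by rewrite -subr_ge0 (_ : 1 / 4 - 5 / 24 = 1 / 24) ?divr_ge0 //; field.
  have q01 : 0 <= (1 / 4 : K) < 1.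
    by rewrite divr_ge0 //= ltr_pdivrMr // mul1r ltr1n.
  rewrite lerD2l; apply: le_trans (geometric_sum_le ler01 q01 (leq_addl N 2)).
  rewrite addn2 [leLHS]big_nat [leRHS]big_nat; apply: ler_sum => n /andP[n2 _].
  by rewrite ltnNge n2 /= ler_wpM2r // exprn_ge0 // divr_ge0.
apply: poly_majorizedD; first exact: poly_majorizedX.
apply: poly_majorizedN.
apply: (@poly_majorized_sum _ _ _ (fun n => higher_coef n *: P N ^+ n)
  (fun n => `|higher_coef n| * (1 / 4) ^+ n)) => n.
by apply: poly_majorizedZ; apply: poly_majorizedX_exp.
Qed.

End Iterates.

(** * Convergence of the iterates to a local inverse *)

Section InverseSeriesExists.
Variable R : realType.
Local Notation C := (Cx R).

Lemma cvg_geometric_close (x y : nat -> C) (l M q : C) : 0 <= q < 1 ->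
  (forall N, `|x N - y N| <= M * q ^+ N) -> y @ \oo --> l -> x @ \oo --> l.
Proof.
move=> q01 xy yl; apply/cvgrPdist_lt => e e0.
have e2 : 0 < e / 2 by rewrite divr_gt0.
have /cvgrPdist_lt/(_ _ e2) Mq : (fun n => M * q ^+ n) @ \oo --> (0 : C).
  by rewrite -[0](mulr0 M); apply: cvgZr; exact: expr_cvg0.
have /cvgrPdist_lt/(_ _ e2) yle := yl.
apply: filterS2 Mq yle => n; rewrite sub0r normrN.
rewrite ger0_norm; last exact: le_trans (normr_ge0 _) (xy n).
move=> Mqe ylen; have -> : l - x n = (l - y n) - (x n - y n) by ring.
have -> : e = e / 2 + e / 2 by field.
by rewrite (le_lt_trans (ler_normB _ _)) // ltrD // (le_lt_trans (xy n)).
Qed.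

(** The radius 1/16 is half of 1/8, so the terms of all iterates at w are dominated by one geometric
    sequence of ratio 1/2. The iterates and the series of stable coefficients then share a limit
    g. *)
Lemma exists_inverse_series (f : C -> C) (a : nat -> C) :
  a 0%N = 0 -> a 1%N = 1 -> (forall n, `|a n| <= 1) ->
  (forall z, `|z| < 1 -> derivable f z 1) ->
  (forall z, `|z| < 1 -> sums_to a z (f z)) ->
  forall w : C, `|w| <= 1 / 16 ->
  exists g : C, [/\ `|g| < 1, f g = w & sums_to (inverse_coef a) w g].
Proof.
move=> a0 a1 a_le1 df fa w w16.
pose P := inverse_iterate a; pose A := inverse_coef a.
have r0 : 0 <= 1 / 8 :> C by rewrite divr_ge0.
have PM N : poly_majorized (1 / 8) (P N) (1 / 4).
  exact: inverse_iterate_majorized.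
have h01 : 0 <= (1 / 2 : C) < 1.
  by rewrite divr_ge0 //= ltr_pdivrMr // mul1r ltr1n.
have q01 : 0 <= (1 / 4 : C) < 1.
  by rewrite divr_ge0 //= ltr_pdivrMr // mul1r ltr1n.
have w8 : `|w| <= 1 / 8.
  rewrite (le_trans w16) // -subr_ge0.
  by rewrite (_ : 1 / 8 - 1 / 16 = 1 / 16) ?divr_ge0 //; field.
have coefPw N n : `|(P N)`_n * w ^+ n| <= 1 / 4 * (1 / 2) ^+ n.
  have -> : (1 / 2 : C) ^+ n = (1 / 16) ^+ n / (1 / 8) ^+ n.
    by rewrite -expr_div_n; congr (_ ^+ _); field.
  rewrite mulrA ler_pdivlMr; last by rewrite exprn_gt0 // divr_gt0.
  rewrite normrM normrX mulrAC; apply: ler_pM.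
  - by rewrite mulr_ge0 // exprn_ge0.
  - by rewrite exprn_ge0.
  - exact: poly_majorized_coef.
  - by rewrite lerXn2r // nnegrE ?divr_ge0.
have Aw n : `|A n * w ^+ n| <= 1 / 4 * (1 / 2) ^+ n by exact: coefPw.
have [g gA] := cvg_geometric_dominated h01 Aw.
have Pser N : `|(P N).[w] - series (fun n => A n * w ^+ n) N.+1| <=
    1 / 4 / (1 - 1 / 2) * (1 / 2) ^+ N.+1.
  rewrite (horner_coef_wide w (leq_maxl (size (P N)) N.+1)).
  rewrite -(big_mkord xpredT (fun i => (P N)`_i * w ^+ i)).
  rewrite (big_cat_nat _ (n := N.+1)) ?leq_maxr //= /series /=.
  rewrite [X in X + _ - _](_ : _ = \sum_(0 <= k < N.+1) A k * w ^+ k).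
    rewrite addrAC subrr add0r (le_trans (ler_norm_sum _ _ _)) //.
    apply: le_trans (geometric_sum_le _ h01 (leq_maxr (size (P N)) N.+1)).
      by apply: ler_sum => i _; exact: coefPw.
    by rewrite divr_ge0.
  by apply: eq_big_nat => k /andP[_ kN]; rewrite coef_inverse_iterate.
have Pg : (fun N => (P N).[w]) @ \oo --> g.
  apply: (cvg_geometric_close (M := 1 / 4 / (1 - 1 / 2) * (1 / 2)) h01 (y :=
    fun N => series (fun n => A n * w ^+ n) N.+1)).
    by move=> N; rewrite -[leRHS]mulrA -exprS.
  by rewrite cvg_shiftS.
have Pw4 N : `|(P N).[w]| <= 1 / 4 by exact: poly_majorized_horner (PM N) w8.
have g4 : `|g| <= 1 / 4 by apply: norm_lim_le Pg _; near=> N.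
have lt1 (x : C) : `|x| <= 1 / 4 -> `|x| < 1.
  by move=> /le_lt_trans; apply; case/andP: q01.
exists g; split=> //; first exact: lt1.
(* By the recursion the bracket is the partial sum of f with N + 2 terms at P_N(w). In the limit it
   becomes w + g - g, and continuity of f gives f g = w. *)
have fP N : `|f (P N).[w] - (w + (P N).[w] - (P N.+1).[w])| <=
    1 / (1 - 1 / 4) * (1 / 4) ^+ N.+2.
  have -> : w + (P N).[w] - (P N.+1).[w] = partial a N.+2 (P N).[w].
    rewrite /P inverse_iterateS -/P hornerD hornerN hornerX horner_sum.
    under eq_bigr do rewrite hornerZ horner_exp.
    rewrite /partial !big_ord_recl /higher_coef /= a0 a1.
    by rewrite /bump /=; ring.
  rewrite partial_seriesE.
  have fz : series (fun n => a n * (P N).[w] ^+ n) @ \oo --> f (P N).[w].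
    exact: (fa _ (lt1 _ (Pw4 N))).
  apply: (@series_tail_le _ _ 1 (1 / 4) _ N.+2 q01 _ fz) => n.
  rewrite normrM normrX ler_pM // ?exprn_ge0 //.
  by rewrite lerXn2r ?nnegrE // divr_ge0.
have fPw : (fun N => f (P N).[w]) @ \oo --> w.
  apply: (cvg_geometric_close (M := 1 / (1 - 1 / 4) * (1 / 4) ^+ 2) q01 (y :=
    fun N => w + (P N).[w] - (P N.+1).[w])).
    by move=> N; rewrite -[leRHS]mulrA -exprD add2n.
  have PSg : (fun N => (P N.+1).[w]) @ \oo --> g.
    by rewrite (cvg_shiftS (fun N => (P N).[w])).
  have cw : (fun=> w : C) @ \oo --> w by exact: cvg_cst.
  rewrite -[X in _ --> X](addrK g w).
  exact: cvgB (cvgD cw Pg) PSg.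
have fPg : (fun N => f (P N).[w]) @ \oo --> f g.
  have /derivable1_diffP/differentiable_continuous fc := df _ (lt1 _ g4).
  exact: (cvg_comp _ _ Pg fc).
exact: (cvg_unique _ fPg fPw).
Unshelve. all: by end_near. Qed.

End InverseSeriesExists.

Section Sharpness.
Variable R : realType.
Local Notation C := (Cx R).

Lemma inverse_coefficients_f0 :
  inverse_coefficients (@f0 R) (inverse_coef (f0_coef R)).
Proof.
split; [exact: inverse_coef0 | exact: inverse_coef1 |].
have [[df _] _] := bounded_turning_f0 R.
have w16 : \forall w \near (0 : C), `|w| <= 1 / 16.
  by apply: nbhs0_le; rewrite divr_gt0.
apply: filterS w16 => w w16.
have [g [g1 fg gA]] := exists_inverse_series (f := @f0 R) erefl erefl
  (@norm_f0_coef R) df (@f0_sums R) w16.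
have fw : (@f0 R @` unit_disc (R:=R)) w by exists g.
have [h1 fh] := disc_inverseP fw.
have gE : disc_inverse (@f0 R) w = g.
  apply: (bounded_turning_inj (bounded_turning_f0 R)).
  - by rewrite inE; exact: h1.
  - by rewrite inE; exact: g1.
  - by rewrite fh fg.
by rewrite gE; split; [exact: fw | exact: gA].
Qed.

(** Here c_1 = c_3 = 0 and c_2 = c_4 = 2, which leaves 4/15 - 16/27. *)
Lemma hankel_f0 : hankel 3 1 (inverse_coef (f0_coef R)) = - (44 / 135) :> C.
Proof.
rewrite (hankel_inverseE (f := @f0 R) erefl erefl (@f0_sums R)
  inverse_coefficients_f0).
by rewrite /hankel_form /f0_coef /=; field.
Qed.

End Sharpness.

Theorem theorem2p1 (R : realType) :
  (forall (f : Cx R -> Cx R) (A : nat -> Cx R),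
     bounded_turning f -> inverse_coefficients f A ->
     `|hankel 3 1 A| <= 44 / 135) /\
  (bounded_turning (@f0 R) /\
   exists A : nat -> Cx R,
     inverse_coefficients (@f0 R) A /\ `|hankel 3 1 A| = 44 / 135).
Proof.
split; first exact: hankel_inverse_bound.
split; first exact: bounded_turning_f0.
exists (inverse_coef (f0_coef R)); split; first exact: inverse_coefficients_f0.
by rewrite hankel_f0 normrN ger0_norm // divr_ge0.
Qed.
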